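(* Let $k\geq 1$ and $\tau\in\mathbb{C}$, $\tau\neq 0$. Then the group $\operatorname{Aut}_R(\mathbb{C}\overline{Q};c)$ of symplectic automorphisms of the path algebra $\mathbb{C}\overline{Q}$ acts transitively on $N_{k,\tau}$.
   Context: Quiver: $Q$ has two vertices $1,2$ and arrows $a$ (a loop at $1$), $x$ (from $2$ to $1$), $y$ (from $1$ to $2$). Its double $\overline{Q}$ has in addition arrows $a^\ast,x^\ast,y^\ast$, where $z^\ast$ goes in the direction opposite to $z$. $\mathbb{C}\overline{Q}$ is the path algebra (paths are written from right to left) and $\pi_1,\pi_2$ are the trivial paths; thus $\pi_1x=x=x\pi_2$, $\pi_2y=y=y\pi_1$, $\pi_2x^\ast=x^\ast=x^\ast\pi_1$, $\pi_1y^\ast=y^\ast=y^\ast\pi_2$, and $a,a^\ast\in\pi_1\mathbb{C}\overline{Q}\pi_1$. Put $R=\mathbb{C}\pi_1\oplus\mathbb{C}\pi_2$. $\operatorname{Aut}_R\mathbb{C}\overline{Q}$ is the group of algebra automorphisms of $\mathbb{C}\overline{Q}$ fixing $R$ pointwise, and $\operatorname{Aut}_R(\mathbb{C}\overline{Q};c)$ is the subgroup of those fixing $c=[a,a^\ast]+[x,x^\ast]+[y,y^\ast]$. Variety: $N_{k,\tau}=\{(A,B,i,j)\in M_{k,k}\times M_{k,k}\times M_{k,2}\times M_{2,k}:\ [A,B]-ij=\tau\cdot 1\}/GL(k,\mathbb{C})$, where $M_{p,q}$ is the space of complex $p\times q$ matrices and $g\in GL(k,\mathbb{C})$ acts by $(gAg^{-1},gBg^{-1},gi,jg^{-1})$.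 Write $i=(i_1,i_2)$ (columns) and $j=\begin{pmatrix}j_1\\ j_2\end{pmatrix}$ (rows). Action: a quadruple $(A,B,i,j)$ is identified with the representation $\rho$ of $\mathbb{C}\overline{Q}$ on $\mathbb{C}^k\oplus\mathbb{C}$ (vertex $1$ carrying $\mathbb{C}^k$, vertex $2$ carrying $\mathbb{C}$) given by $a\mapsto A$, $a^\ast\mapsto B$, $x\mapsto -i_1$, $x^\ast\mapsto j_1$, $y\mapsto j_2$, $y^\ast\mapsto i_2$. An automorphism $\phi$ acts by $\rho\mapsto\rho\circ\phi$, i.e. by evaluating the non-commutative polynomials $\phi(a),\phi(a^\ast),\phi(x),\dots$ on the given matrices. For $\phi\in\operatorname{Aut}_R(\mathbb{C}\overline{Q};c)$ this preserves the equation $[A,B]-ij=\tau\cdot 1$ and commutes with $GL(k,\mathbb{C})$, and so it induces an action on $N_{k,\tau}$. *)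

(* Defs.v *)
From HB Require Import structures.
From mathcomp Require Import all_boot all_order all_algebra.
From mathcomp Require Import generic_quotient boolp reals complex.
From mathcomp Require Import finmap.
From mathcomp.multinomials Require Import monalg.

Set Implicit Arguments.
Unset Strict Implicit.
Unset Printing Implicit Defensive.

Import GRing.Theory.
Local Open Scope ring_scope.
Local Open Scope quotient_scope.

Record quiver := Quiver {
  vert : finType;
  arr : finType;
  src : arr -> vert;
  tgt : arr -> vert
}.

(* [inl z] is the arrow z and [inr z] is the opposite arrow z^*. *)
Definition double (Q : quiver) : quiver :=
  @Quiver (vert Q) (arr Q + arr Q)%type
    (fun z => match z with inl b => src b | inr b => tgt b end)
    (fun z => match z with inl b => tgt b | inr b => src b end).

Section Paths.
Variable Q : quiver.

(* A path is written from right to left: it is the pair (t, [:: b1; ..; bn])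
   with t = tgt b1, src b1 = tgt b2, .., and it starts at src bn.  The pair
   (t, [::]) is the trivial path at t. *)
Fixpoint is_path (t : vert Q) (s : seq (arr Q)) : bool :=
  if s is b :: s' then (tgt b == t) && is_path (src b) s' else true.

Definition qpath := {p : vert Q * seq (arr Q) | is_path p.1 p.2}.

Definition ptgt (p : qpath) : vert Q := (val p).1.
Definition parrs (p : qpath) : seq (arr Q) := (val p).2.
Definition psrc (p : qpath) : vert Q := last (ptgt p) [seq src b | b <- parrs p].

Definition ptriv (v : vert Q) : qpath := exist _ (v, [::]) isT.

Lemma parr_subproof (b : arr Q) : is_path (tgt b) [:: b].
Proof. by rewrite /= eqxx. Qed.
Definition parr (b : arr Q) : qpath := exist _ (tgt b, [:: b]) (parr_subproof b).

(* [None] when the two paths are not composable. *)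
Definition pcat (p q : qpath) : option qpath :=
  if psrc p == ptgt q
  then (insub (ptgt p, parrs p ++ parrs q) : option qpath) else None.

Lemma is_path_cat t s1 s2 :
  is_path t (s1 ++ s2) = is_path t s1 && is_path (last t [seq src b | b <- s1]) s2.
Proof. by elim: s1 t => [|b s1 IH] t //=; rewrite IH andbA. Qed.

Lemma pcat_some p q : psrc p = ptgt q ->
  exists2 r, pcat p q = Some r & val r = (ptgt p, parrs p ++ parrs q).
Proof.
move=> e; rewrite /pcat e eqxx; case: insubP => [r _ vr|]; first by exists r.
by rewrite /= is_path_cat -/(psrc p) e (valP p) (valP q).
Qed.

Lemma pcat_none p q : psrc p != ptgt q -> pcat p q = None.
Proof. by rewrite /pcat => /negbTE ->. Qed.

Lemma psrc_val (r p q : qpath) : psrc p = ptgt q ->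
  val r = (ptgt p, parrs p ++ parrs q) -> psrc r = psrc q /\ ptgt r = ptgt p.
Proof.
move=> e vr; rewrite {1}/psrc /ptgt /parrs vr /= map_cat last_cat.
by rewrite -/(psrc p) e.
Qed.

Lemma pcatA p q r :
  obind (fun pq => pcat pq r) (pcat p q) = obind (pcat p) (pcat q r).
Proof.
have [e1|n1] := eqVneq (psrc p) (ptgt q); have [e2|n2] := eqVneq (psrc q) (ptgt r).
- have [pq -> vpq] := pcat_some e1; have [qr -> vqr] := pcat_some e2 => /=.
  have [spq tpq] := psrc_val e1 vpq; have [sqr tqr] := psrc_val e2 vqr.
  have e3 : psrc pq = ptgt r by rewrite spq.
  have e4 : psrc p = ptgt qr by rewrite tqr.
  have [x -> vx] := pcat_some e3; have [y -> vy] := pcat_some e4.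
  congr Some; apply: val_inj; rewrite vx vy tpq.
  by rewrite /parrs vpq vqr /= catA.
- have [pq -> vpq] := pcat_some e1 => /=; have [spq tpq] := psrc_val e1 vpq.
  by rewrite (pcat_none n2) /= pcat_none // spq.
- have [qr -> vqr] := pcat_some e2 => /=; have [sqr tqr] := psrc_val e2 vqr.
  by rewrite (pcat_none n1) /= pcat_none // tqr.
- by rewrite (pcat_none n1) (pcat_none n2).
Qed.

Lemma pcat_trivl v p : pcat (ptriv v) p = if v == ptgt p then Some p else None.
Proof.
have [->|n] := eqVneq v (ptgt p); last by rewrite pcat_none.
have [//|r -> vr] := @pcat_some (ptriv (ptgt p)) p.
by congr Some; apply: val_inj; rewrite vr; case: p {r vr} => -[].
Qed.

Lemma pcat_trivr v p : pcat p (ptriv v) = if v == psrc p then Some p else None.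
Proof.
rewrite [v == _]eq_sym; have [e|n] := eqVneq (psrc p) v; last by rewrite pcat_none.
have [//|r -> vr] := @pcat_some p (ptriv v).
by congr Some; apply: val_inj; rewrite vr cats0; case: p {e r vr} => -[].
Qed.

End Paths.

(* Finitely supported functions on paths. *)
Definition path_algebra (F : fieldType) (Q : quiver) : Type := {malg F[qpath Q]}.

HB.instance Definition _ F Q :=
  GRing.Lmodule.copy (path_algebra F Q) {malg F[qpath Q]}.

(* Locked: unfolding the finite maps underneath makes unification diverge. *)
HB.lock Definition pbasis (F : fieldType) (Q : quiver) (p : qpath Q) :
    path_algebra F Q := << p >>.
Arguments pbasis F {Q} p.

(* The linear extension of a function defined on paths. *)
HB.lock Definition linext (F : fieldType) (Q : quiver) (V : lmodType F)
    (h : qpath Q -> V) (u : path_algebra F Q) : V :=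
  \sum_(p <- msupp u) u@_p *: h p.
Arguments linext {F Q V} h u.

Section LinearExtension.
Variables (F : fieldType) (Q : quiver) (V : lmodType F).
Implicit Types (h : qpath Q -> V) (u v : path_algebra F Q).

Lemma linextEw h u (d : {fset qpath Q}) : (msupp u `<=` d)%fset ->
  linext h u = \sum_(p <- d) u@_p *: h p.
Proof.
by rewrite linext.unlock => le; apply: big_fset_incl => // p _ /mcoeff_outdom ->; rewrite scale0r.
Qed.

Lemma linext_is_linear h : linear (linext h).
Proof.
move=> a u v; pose d := (msupp u `|` msupp v)%fset.
rewrite (@linextEw h u d) ?fsubsetUl // (@linextEw h v d) ?fsubsetUr //.
rewrite (@linextEw h (a *: u + v) d).
  rewrite scaler_sumr -big_split /=; apply: eq_bigr => p _.
  by rewrite mcoeffD mcoeffZ scalerDl scalerA.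
apply: fsubset_trans (msuppD_le _ _) _.
by apply: fsetSU; apply: msuppZ_le.
Qed.

HB.instance Definition _ h :=
  GRing.isLinear.Build F (path_algebra F Q) V *:%R (linext h) (linext_is_linear h).

Lemma linext_linear a h1 h2 u :
  linext (fun p => a *: h1 p + h2 p) u = a *: linext h1 u + linext h2 u.
Proof.
rewrite linext.unlock scaler_sumr -big_split /=; apply: eq_bigr => p _.
by rewrite scalerDr !scalerA [a * _]mulrC.
Qed.

Lemma linextU h p : linext h (pbasis F p) = h p.
Proof. by rewrite linext.unlock pbasis.unlock msuppU oner_eq0 big_seq_fset1 mcoeffUU scale1r. Qed.

Lemma malgZU (c : F) (p : qpath Q) : << c *g p >> = c *: << p >> :> {malg F[qpath Q]}.
Proof. by apply/malgP => q; rewrite mcoeffZ [LHS]mcoeffU mcoeffU mulr_natr. Qed.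

Lemma path_algebraE u : u = \sum_(p <- msupp u) u@_p *: pbasis F p.
Proof.
rewrite [LHS]monalgE; apply: eq_bigr => p _; rewrite pbasis.unlock; exact: malgZU.
Qed.

Lemma linear_ext (f g : path_algebra F Q -> V) : linear f -> linear g ->
  (forall p, f (pbasis F p) = g (pbasis F p)) -> f =1 g.
Proof.
move=> lf lg fg u.
pose Lf := GRing.isLinear.Build F (path_algebra F Q) V *:%R f lf.
pose Lg := GRing.isLinear.Build F (path_algebra F Q) V *:%R g lg.
pose f' : {linear path_algebra F Q -> V} := HB.pack f Lf.
pose g' : {linear path_algebra F Q -> V} := HB.pack g Lg.
rewrite -[f u]/(f' u) -[g u]/(g' u) [u]path_algebraE !linear_sum.
by apply: eq_bigr => p _; rewrite !linearZ /= fg.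
Qed.

End LinearExtension.

Definition pathmul (F : fieldType) (Q : quiver) (p q : qpath Q) : path_algebra F Q :=
  if pcat p q is Some r then pbasis F r else 0.
Arguments pathmul F {Q} p q.

HB.lock Definition palg_mul (F : fieldType) (Q : quiver) (u v : path_algebra F Q) :
    path_algebra F Q :=
  linext (fun p => linext (pathmul F p) v) u.
Arguments palg_mul {F Q} u v.

Section PathAlgebra.
Variables (F : fieldType) (Q : quiver).
Local Notation A := (path_algebra F Q).
Implicit Types (u v w : A) (p q : qpath Q).

Definition palg_one : A := \sum_(v : vert Q) pbasis F (ptriv v).

Lemma palg_mulUU p q : palg_mul (pbasis F p) (pbasis F q) = pathmul F p q.
Proof. by rewrite unlock !linextU. Qed.

Lemma palg_mull v : linear (fun u => palg_mul u v).
Proof. by move=> a u w; rewrite unlock linearP. Qed.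

Lemma palg_mulr u : linear (palg_mul u).
Proof.
move=> a v w; rewrite [in LHS]palg_mul.unlock.
have -> : (fun p : qpath Q => linext (pathmul F p) (a *: v + w)) =
          (fun p : qpath Q => a *: linext (pathmul F p) v + linext (pathmul F p) w).
  by apply/funext => p; rewrite linearP.
by rewrite linext_linear !palg_mul.unlock.
Qed.

HB.instance Definition _ u :=
  GRing.isLinear.Build F A A *:%R (palg_mul u) (palg_mulr u).

Definition palg_mulC u v := palg_mul v u.
HB.instance Definition _ u :=
  GRing.isLinear.Build F A A *:%R (palg_mulC u) (palg_mull u).

Lemma palg_mulPl a u v w : palg_mul (a *: u + v) w = a *: palg_mul u w + palg_mul v w.
Proof. exact: palg_mull. Qed.

Lemma palg_mulPr a u v w : palg_mul w (a *: u + v) = a *: palg_mul w u + palg_mul w v.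
Proof. exact: palg_mulr. Qed.

Lemma palg_mulA : associative (@palg_mul F Q).
Proof.
move=> u v w; move: w; apply: (@linear_ext F Q A).
- by move=> a x y; rewrite !palg_mulPr.
- by move=> a x y; rewrite !palg_mulPr.
move=> r; move: v; apply: (@linear_ext F Q A).
- by move=> a x y; rewrite palg_mulPl palg_mulPr.
- by move=> a x y; rewrite palg_mulPr palg_mulPl.
move=> q; move: u; apply: (@linear_ext F Q A).
- by move=> a x y; rewrite palg_mulPl.
- by move=> a x y; rewrite !palg_mulPl.
move=> p; rewrite (palg_mulUU p q) (palg_mulUU q r).
have l0 (x : A) : palg_mul x 0 = 0.
  by rewrite linear0.
have r0 (x : A) : palg_mul 0 x = 0.
  by rewrite -[LHS]/(palg_mulC x 0) linear0.
have:= pcatA p q r; rewrite /pathmul.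
case: (pcat p q) => [pq|] /=; case: (pcat q r) => [qr|] /= e;
  rewrite ?(l0, r0) //.
- by rewrite (palg_mulUU p qr) (palg_mulUU pq r) /pathmul e.
- by rewrite (palg_mulUU pq r) /pathmul e.
- by rewrite (palg_mulUU p qr) /pathmul -e.
Qed.

Lemma palg_mul1 : left_id palg_one (@palg_mul F Q).
Proof.
apply: (@linear_ext F Q A) => [a x y|//|p]; first exact: palg_mulPr.
rewrite -[LHS]/(palg_mulC (pbasis F p) palg_one) linear_sum (bigD1 (ptgt p)) //=.
rewrite /palg_mulC palg_mulUU /pathmul pcat_trivl eqxx big1 ?addr0 // => v ne.
by rewrite palg_mulUU /pathmul pcat_trivl (negbTE ne).
Qed.

Lemma palg_mulr1 : right_id palg_one (@palg_mul F Q).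
Proof.
apply: (@linear_ext F Q A) => [a x y|//|p]; first exact: palg_mulPl.
rewrite linear_sum (bigD1 (psrc p)) //=.
rewrite palg_mulUU /pathmul pcat_trivr eqxx big1 ?addr0 // => v ne.
by rewrite palg_mulUU /pathmul pcat_trivr (negbTE ne).
Qed.

Lemma palg_mulDl : left_distributive (@palg_mul F Q) +%R.
Proof. by move=> u v w; have := palg_mulPl 1 u v w; rewrite !scale1r. Qed.

Lemma palg_mulDr : right_distributive (@palg_mul F Q) +%R.
Proof. by move=> w u v; have := palg_mulPr 1 u v w; rewrite !scale1r. Qed.

HB.instance Definition _ := GRing.Zmodule_isPzRing.Build A
  palg_mulA palg_mul1 palg_mulr1 palg_mulDl palg_mulDr.

Definition vtx (v : vert Q) : A := pbasis F (ptriv v).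
Definition arw (b : arr Q) : A := pbasis F (parr b).

Lemma palg_mulUUE p q : pbasis F p * (pbasis F q) = pathmul F p q.
Proof. exact: palg_mulUU. Qed.

Lemma palg_scalerAl (a : F) u v : a *: (u * v) = a *: u * v.
Proof. by rewrite -[RHS]/(palg_mulC v (a *: u)) linearZ. Qed.

Lemma palg_scalerAr (a : F) u v : a *: (u * v) = u * (a *: v).
Proof. by rewrite -[RHS]/(palg_mul u (a *: v)) linearZ. Qed.

Lemma vtx_arw b : vtx (tgt b) * arw b = arw b.
Proof. by rewrite palg_mulUUE /pathmul pcat_trivl eqxx. Qed.

Lemma arw_vtx b : arw b * vtx (src b) = arw b.
Proof. by rewrite palg_mulUUE /pathmul pcat_trivr eqxx. Qed.

Lemma palg_prodE (p : qpath Q) :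
  pbasis F p = vtx (ptgt p) * \prod_(b <- parrs p) arw b.
Proof.
case: p => -[t s] /=; rewrite /ptgt /parrs /=.
elim: s t => [|b s IH] t ps; first by rewrite big_nil mulr1; congr pbasis; apply: val_inj.
have /andP [/eqP et ps'] := ps.
rewrite big_cons -{1}[arw b]arw_vtx -[_ * _ * _]mulrA -(IH _ ps') mulrA.
have -> : vtx t * arw b = arw b by rewrite -et vtx_arw.
rewrite palg_mulUUE /pathmul; have [//|r -> vr] := @pcat_some Q (parr b) (exist _ (src b, s) ps').
by congr pbasis; apply: val_inj; rewrite vr /ptgt /parrs /= et.
Qed.

(* [r] ranges over the coefficients of an arbitrary element of the span of the
   trivial paths. *)
Definition is_autR (f : A -> A) : Prop :=
  [/\ linear f, f 1 = 1, {morph f : u v / u * v}, bijective f &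
      forall r : vert Q -> F, f (\sum_x r x *: vtx x) = \sum_x r x *: vtx x].

Lemma autR_vtx f x : is_autR f -> f (vtx x) = vtx x.
Proof.
case=> _ _ _ _ /(_ (fun y => (y == x)%:R)).
rewrite (bigD1 x) //= big1 ?eqxx ?scale1r ?addr0 // => y /negbTE ->.
by rewrite scale0r.
Qed.

Variable c : A.

Definition is_autRc (f : A -> A) : Prop := is_autR f /\ f c = c.

Definition autRc : Type := {f : A -> A | `[< is_autRc f >]}.
HB.instance Definition _ := Choice.on autRc.

Lemma autRcP (f : autRc) : is_autRc (val f).
Proof. exact/asboolP/(valP f). Qed.

Lemma is_autRc_id : is_autRc id.
Proof. by split=> //; split=> //; exists id. Qed.

Lemma is_autRc_comp f g : is_autRc f -> is_autRc g -> is_autRc (f \o g).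
Proof.
move=> [[lf f1 fM bf fR] fc] [[lg g1 gM bg gR] gc]; split; last by rewrite /= gc.
split=> /=; rewrite ?g1 //.
- by move=> a u v /=; rewrite lg lf.
- by move=> u v /=; rewrite gM fM.
- exact: bij_comp.
- by move=> r; rewrite gR fR.
Qed.

Lemma is_autRc_inv f g : is_autRc f -> cancel f g -> cancel g f -> is_autRc g.
Proof.
move=> [[lf f1 fM bf fR] fc] fK gK; split; last by rewrite -{1}fc fK.
split.
- by move=> a u v; apply: (can_inj fK); rewrite lf !gK.
- by apply: (can_inj fK); rewrite f1 gK.
- by move=> u v; apply: (can_inj fK); rewrite fM !gK.
- by exists f.
- by move=> r; rewrite -[in LHS]fR fK.
Qed.

Lemma autRc_inv_ex (f : autRc) :
  {g : autRc | cancel (val f) (val g) /\ cancel (val g) (val f)}.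
Proof.
apply: cid; have Pf := autRcP f; have [[_ _ _ [g fK gK] _] _] := Pf.
have /asboolP Pg := is_autRc_inv Pf fK gK.
by exists (exist _ g Pg).
Qed.

(* The group law is composition, f * g = f \o g. *)
Definition autRc_one : autRc := exist _ id (introT (asboolP _) is_autRc_id).
Definition autRc_mul (f g : autRc) : autRc :=
  exist _ (val f \o val g)
    (introT (asboolP _) (is_autRc_comp (autRcP f) (autRcP g))).
Definition autRc_inv (f : autRc) : autRc := sval (autRc_inv_ex f).

Lemma autRc_mulA : associative autRc_mul.
Proof. by move=> f g h; apply: val_inj. Qed.
Lemma autRc_mul1 : left_id autRc_one autRc_mul.
Proof. by move=> f; apply: val_inj. Qed.
Lemma autRc_mulr1 : right_id autRc_one autRc_mul.
Proof. by move=> f; apply: val_inj. Qed.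
Lemma autRc_mulV : left_inverse autRc_one autRc_inv autRc_mul.
Proof.
move=> f; apply: val_inj; apply/funext => u /=.
by rewrite /autRc_inv; case: autRc_inv_ex => g [fK gK] /=; rewrite fK.
Qed.
Lemma autRc_mulrV : right_inverse autRc_one autRc_inv autRc_mul.
Proof.
move=> f; apply: val_inj; apply/funext => u /=.
by rewrite /autRc_inv; case: autRc_inv_ex => g [fK gK] /=; rewrite gK.
Qed.

HB.instance Definition _ := isGroup.Build autRc autRc_mulA
  autRc_mul1 autRc_mulr1 autRc_mulV autRc_mulrV.

End PathAlgebra.

(* Precomposing representations with automorphisms is an action on the right. *)
Record right_action (G : groupType) (T : Type) := RightAction {
  ract :> T -> G -> T;
  ract1 : forall t, ract t 1%g = t;
  ractM : forall t g h, ract t (g * h)%g = ract (ract t g) h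
}.

Definition acts_transitively (G : groupType) (T : Type) (to : right_action G T) :=
  forall t u : T, exists g : G, to t g = u.

(* Evaluation of path algebra elements on square matrices M b attached to the
   arrows b, E v being the projector onto the summand at the vertex v. *)
Section Evaluation.
Variables (F : fieldType) (Q : quiver) (n : nat).
Variables (E : vert Q -> 'M[F]_n) (M : arr Q -> 'M[F]_n).
Local Notation A := (path_algebra F Q).

Definition evpath (p : qpath Q) : 'M[F]_n := E (ptgt p) * \prod_(b <- parrs p) M b.

Definition evalg : A -> 'M[F]_n := linext evpath.
HB.instance Definition _ := GRing.Linear.on evalg.

Hypothesis E_id : forall v, E v * E v = E v.
Hypothesis E_orth : forall v w, v != w -> E v * E w = 0.
Hypothesis E_sum : \sum_v E v = 1.
Hypothesis ME : forall b, M b * E (src b) = M b.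
Hypothesis EM : forall b, E (tgt b) * M b = M b.

Lemma evalg_path p : evalg (pbasis F p) = evpath p.
Proof. exact: linextU. Qed.

Lemma evalg_vtx v : evalg (vtx F v) = E v.
Proof. by rewrite evalg_path /evpath big_nil mulr1. Qed.

Lemma evalg_arw b : evalg (arw F b) = M b.
Proof. by rewrite evalg_path /evpath big_seq1 EM. Qed.

Lemma evpath_src p : evpath p * E (psrc p) = evpath p.
Proof.
case: p => -[t s] ps; rewrite /evpath /psrc /ptgt /parrs /=.
elim: s t ps => [|b s IH] t /=; first by rewrite big_nil mulr1 E_id.
case/andP=> _ /IH; rewrite -mulrA big_cons => e.
by rewrite -[M b]ME -!mulrA e.
Qed.

Lemma evpath_mul p q : evalg (pathmul F p q) = evpath p * evpath q.
Proof.
rewrite /pathmul; have [e|ne] := eqVneq (psrc p) (ptgt q).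
  have [r -> vr] := pcat_some e.
  have -> : evpath p * evpath q = evpath p * \prod_(b <- parrs q) M b.
    by rewrite [evpath q]/evpath -e mulrA evpath_src.
  by rewrite evalg_path /evpath /ptgt [parrs r]/parrs vr /= big_cat mulrA.
rewrite (pcat_none ne) linear0 -[evpath p]evpath_src -mulrA [evpath q]/evpath.
by rewrite [E _ * (E _ * _)]mulrA E_orth // mul0r mulr0.
Qed.

Lemma evalg1 : evalg 1 = 1.
Proof.
by rewrite -[1 in LHS]/(palg_one _ _) linear_sum -E_sum; apply: eq_bigr => v _; rewrite -evalg_vtx.
Qed.

Lemma evalgM : {morph evalg : u v / u * v}.
Proof.
have scAl (a : F) (x y : 'M[F]_n) : a *: (x * y) = a *: x * y by exact: scalemxAl.
have scAr (a : F) (x y : 'M[F]_n) : a *: (x * y) = x * (a *: y) by exact: scalemxAr.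
move=> u v; move: v; apply: (@linear_ext F Q).
- by move=> a x y; rewrite mulrDr -palg_scalerAr linearP.
- by move=> a x y; rewrite linearP mulrDr scAr.
move=> q; move: u; apply: (@linear_ext F Q).
- by move=> a x y; rewrite mulrDl -palg_scalerAl linearP.
- by move=> a x y; rewrite linearP mulrDl scAl.
by move=> p; rewrite palg_mulUUE evpath_mul !evalg_path.
Qed.

Lemma evalg_unique (f : A -> 'M[F]_n) : linear f -> {morph f : u v / u * v} ->
  (f 1 = 1) -> (forall v, f (vtx F v) = E v) -> (forall b, f (arw F b) = M b) ->
  f =1 evalg.
Proof.
move=> lf fM f1 fv fa; apply: linear_ext => //; first exact: linext_is_linear.
move=> p; rewrite evalg_path palg_prodE fM fv /evpath; congr (_ * _).
by elim: (parrs p) => [|b s IH]; rewrite ?big_nil // !big_cons fM fa IH.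
Qed.

End Evaluation.

Variant bp_vert := V1 | V2.
Variant bp_arr := Arr_a | Arr_x | Arr_y.

Definition bool_of_vert v := if v is V1 then true else false.
Definition vert_of_bool (b : bool) := if b then V1 else V2.
Lemma bool_of_vertK : cancel bool_of_vert vert_of_bool. Proof. by case. Qed.
HB.instance Definition _ := Finite.copy bp_vert (can_type bool_of_vertK).

Definition opt_of_arr z :=
  match z with Arr_a => None | Arr_x => Some true | Arr_y => Some false end.
Definition arr_of_opt o :=
  match o with None => Arr_a | Some true => Arr_x | Some false => Arr_y end.
Lemma opt_of_arrK : cancel opt_of_arr arr_of_opt. Proof. by case. Qed.
HB.instance Definition _ := Finite.copy bp_arr (can_type opt_of_arrK).

Definition bp_quiver : quiver := @Quiver bp_vert bp_arr
  (fun z => if z is Arr_x then V2 else V1)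
  (fun z => if z is Arr_y then V2 else V1).

Lemma sum_vert (M : nmodType) (f : bp_vert -> M) : \sum_v f v = f V1 + f V2.
Proof.
rewrite (reindex vert_of_bool) /=; last first.
  by exists bool_of_vert => [[]|[]].
by rewrite big_bool.
Qed.

Section Action.
Variable F : fieldType.

Local Notation DQ := (double bp_quiver).
Local Notation A := (path_algebra F DQ).

(* A prime marks the starred arrows. *)
Definition bpa : A := arw F (inl Arr_a : arr DQ).
Definition bpx : A := arw F (inl Arr_x : arr DQ).
Definition bpy : A := arw F (inl Arr_y : arr DQ).
Definition bpa' : A := arw F (inr Arr_a : arr DQ).
Definition bpx' : A := arw F (inr Arr_x : arr DQ).
Definition bpy' : A := arw F (inr Arr_y : arr DQ).

Definition comm_br (R : pzRingType) (u v : R) : R := u * v - v * u.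

Definition bpc : A := comm_br bpa bpa' + comm_br bpx bpx' + comm_br bpy bpy'.

Definition symp_aut : groupType := autRc bpc.

Variable k : nat.

Definition quad : Type := 'M[F]_k * 'M[F]_k * 'M[F]_(k, 1 + 1) * 'M[F]_(1 + 1, k).
HB.instance Definition _ := Choice.on quad.

Implicit Type q : quad.
Definition qA q : 'M[F]_k := q.1.1.1.
Definition qB q : 'M[F]_k := q.1.1.2.
Definition qi q : 'M[F]_(k, 1 + 1) := q.1.2.
Definition qj q : 'M[F]_(1 + 1, k) := q.2.
Definition qi1 q : 'cV[F]_k := lsubmx (qi q).
Definition qi2 q : 'cV[F]_k := rsubmx (qi q).
Definition qj1 q : 'rV[F]_k := usubmx (qj q).
Definition qj2 q : 'rV[F]_k := dsubmx (qj q).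

(* Endomorphisms of F^k (+) F, acting on column vectors; the block F^k sits at
   V1 and the block F at V2. *)
Definition bpE (v : vert DQ) : 'M[F]_(k + 1) :=
  match v with V1 => block_mx 1%:M 0 0 0 | V2 => block_mx 0 0 0 1%:M end.

Definition bpM q (z : arr DQ) : 'M[F]_(k + 1) :=
  match z with
  | inl Arr_a => block_mx (qA q) 0 0 0
  | inr Arr_a => block_mx (qB q) 0 0 0
  | inl Arr_x => block_mx 0 (- qi1 q) 0 0
  | inr Arr_x => block_mx 0 0 (qj1 q) 0
  | inl Arr_y => block_mx 0 0 (qj2 q) 0
  | inr Arr_y => block_mx 0 (qi2 q) 0 0
  end.

Definition rep q : A -> 'M[F]_(k + 1) := evalg bpE (bpM q).
HB.instance Definition _ q := GRing.Linear.on (rep q).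

Lemma bpE_id v : bpE v * bpE v = bpE v.
Proof.
by case: v; rewrite -mulmxE mulmx_block !(mulmx0, mul0mx, mulmx1, addr0, add0r).
Qed.

Lemma bpE_orth v w : v != w -> bpE v * bpE w = 0.
Proof.
by case: v; case: w => // _;
  rewrite -mulmxE mulmx_block !(mulmx0, mul0mx, addr0) ?block_mx0.
Qed.

Lemma bpE_sum : \sum_v bpE v = 1.
Proof.
by rewrite sum_vert /= add_block_mx !(addr0, add0r) -idmxE scalar_mx_block.
Qed.

Lemma bpME q z : bpM q z * bpE (src z) = bpM q z.
Proof.
by case: z => -[]; rewrite -mulmxE mulmx_block !(mulmx0, mul0mx, mulmx1, addr0, add0r).
Qed.

Lemma bpEM q z : bpE (tgt z) * bpM q z = bpM q z.
Proof.
by case: z => -[]; rewrite -mulmxE mulmx_block !(mulmx0, mul0mx, mul1mx, addr0, add0r).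
Qed.

Lemma rep_linear q : linear (rep q).
Proof. exact: linext_is_linear. Qed.
Lemma rep1 q : rep q 1 = 1.
Proof. exact: (evalg1 _ bpE_sum). Qed.
Lemma repM q : {morph rep q : u v / u * v}.
Proof. exact: (evalgM bpE_id bpE_orth (bpME q)). Qed.
Lemma rep_vtx q v : rep q (vtx F v) = bpE v.
Proof. exact: evalg_vtx. Qed.
Lemma rep_arw q z : rep q (arw F z) = bpM q z.
Proof. exact: (evalg_arw (bpEM q)). Qed.

(* The quadruple of the representation [rep q \o f]. *)
Definition act_quad q (f : A -> A) : quad :=
  (ulsubmx (rep q (f bpa)), ulsubmx (rep q (f bpa')),
   row_mx (- ursubmx (rep q (f bpx))) (ursubmx (rep q (f bpy'))),
   col_mx (dlsubmx (rep q (f bpx'))) (dlsubmx (rep q (f bpy)))).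

Lemma bpEME (v w : vert DQ) (X : 'M[F]_(k + 1)) : bpE v * X * bpE w =
  match v, w with
  | V1, V1 => block_mx (ulsubmx X) 0 0 0
  | V1, V2 => block_mx 0 (ursubmx X) 0 0
  | V2, V1 => block_mx 0 0 (dlsubmx X) 0
  | V2, V2 => block_mx 0 0 0 (drsubmx X)
  end.
Proof.
rewrite -mulmxE -{1}[X]submxK.
by case: v; case: w;
  rewrite !mulmx_block !(mulmx0, mul0mx, mul1mx, mulmx1, addr0, add0r).
Qed.

Lemma autR_arwE (f : A -> A) z : is_autR f ->
  f (arw F z) = vtx F (tgt z) * f (arw F z) * vtx F (src z).
Proof.
move=> Pf; have [_ _ fM _ _] := Pf.
by rewrite -{1}[arw F z]vtx_arw -{1}[arw F z]arw_vtx !fM !(autR_vtx _ Pf) mulrA.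
Qed.

Lemma rep_act_quad q f : is_autR f -> rep (act_quad q f) =1 rep q \o f.
Proof.
move=> Pf; have [lf f1 fM _ _] := Pf.
apply: fsym; apply: (evalg_unique (M := bpM (act_quad q f))) => /=.
- by move=> a u v; rewrite /= lf rep_linear.
- by move=> u v; rewrite /= fM repM.
- by rewrite /= f1 rep1.
- by move=> v; rewrite /= autR_vtx // rep_vtx.
move=> z; rewrite /= (autR_arwE z Pf) !repM !rep_vtx bpEME.
case: z => -[] /=; rewrite /qA /qB /qi1 /qi2 /qj1 /qj2 /qi /qj /=
  ?row_mxKl ?row_mxKr ?col_mxKu ?col_mxKd ?opprK //.
Qed.

Definition gl_act (g : 'M[F]_k) q : quad :=
  (g *m qA q *m invmx g, g *m qB q *m invmx g, g *m qi q, qj q *m invmx g).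

Definition moment q : 'M[F]_k := qA q *m qB q - qB q *m qA q - qi q *m qj q.

Lemma rep_bpc q :
  rep q bpc = block_mx (moment q) 0 0 (qj1 q *m qi1 q + qj2 q *m qi2 q).
Proof.
rewrite /bpc /comm_br !(linearD, linearN) /= !repM !rep_arw /= -!mulmxE.
rewrite !mulmx_block !(mulmx0, mul0mx, addr0, add0r) !opp_block_mx !oppr0.
rewrite !add_block_mx !(addr0, add0r); congr block_mx.
  rewrite /moment -[qi q]hsubmxK -[qj q]vsubmxK mul_row_col.
  by rewrite mulNmx opprD addrA.
by rewrite mulmxN opprK.
Qed.

Lemma moment_act q f : is_autRc bpc f -> moment (act_quad q f) = moment q.
Proof.
case=> Pf fc; have := rep_act_quad q Pf bpc.
by rewrite /= fc !rep_bpc => /(congr1 ulsubmx); rewrite !block_mxKul.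
Qed.

Lemma moment_gl g q : g \in unitmx -> moment (gl_act g q) = g *m moment q *m invmx g.
Proof.
move=> ug; rewrite /moment /gl_act /qA /qB /qi /qj /=.
rewrite !mulmxBr !mulmxBl !mulmxA; congr (_ - _ - _);
  by rewrite -!mulmxA (mulKmx ug).
Qed.

Lemma rep_gl g q u : g \in unitmx -> rep (gl_act g q) u =
  block_mx g 0 0 1%:M *m rep q u *m block_mx (invmx g) 0 0 1%:M.
Proof.
move=> ug; move: u; apply: fsym.
apply: (evalg_unique (M := bpM (gl_act g q))).
- by move=> a u v; rewrite linearP /= mulmxDr mulmxDl -scalemxAr -scalemxAl.
- move=> u v; rewrite repM -!mulmxE !mulmxA; congr (_ *m _).
  rewrite -!mulmxA; congr (_ *m (_ *m _)); rewrite mulmxA mulmx_block.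
  by rewrite !(mulmx0, mul0mx, mulmx1, mul1mx, addr0, add0r) mulVmx // -scalar_mx_block mul1mx.
- rewrite rep1 -idmxE mulmx1 mulmx_block.
  by rewrite !(mulmx0, mul0mx, mulmx1, mul1mx, addr0, add0r) mulmxV // -scalar_mx_block.
- move=> v; rewrite rep_vtx; case: v;
    rewrite !mulmx_block !(mulmx0, mul0mx, mulmx1, mul1mx, addr0, add0r) //.
  by rewrite mulmxV.
move=> z; rewrite rep_arw; case: z => -[]; rewrite /bpM /gl_act /qA /qB /qi1 /qi2 /qj1 /qj2 /qi /qj /=
    !mulmx_block !(mulmx0, mul0mx, mulmx1, mul1mx, addr0, add0r) ?mulmxN //;
  congr block_mx.
- by rewrite -mulmx_lsub.
- by rewrite -mul_dsub_mx.
- by rewrite -mul_usub_mx.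
- by rewrite -mulmx_rsub.
Qed.

Lemma act_quad_gl g q f : g \in unitmx ->
  act_quad (gl_act g q) f = gl_act g (act_quad q f).
Proof.
move=> ug; rewrite /act_quad /gl_act /qA /qB /qi /qj /= !rep_gl //.
have E X : block_mx g 0 0 1%:M *m X *m block_mx (invmx g) 0 0 1%:M =
    block_mx (g *m ulsubmx X *m invmx g) (g *m ursubmx X)
             (dlsubmx X *m invmx g) (drsubmx X).
  rewrite -{1}[X]submxK !mulmx_block.
  by rewrite !(mulmx0, mul0mx, mulmx1, mul1mx, addr0, add0r).
rewrite !E !(block_mxKul, block_mxKur, block_mxKdl).
by rewrite mul_mx_row mul_col_mx mulmxN.
Qed.

Lemma act_quad_id q : act_quad q id = q.
Proof.
rewrite /act_quad !rep_arw /= !(block_mxKul, block_mxKur, block_mxKdl) opprK.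
by rewrite hsubmxK vsubmxK; case: q => [[[? ?] ?] ?].
Qed.

Lemma act_quad_comp q f h : is_autR f ->
  act_quad q (f \o h) = act_quad (act_quad q f) h.
Proof. by move=> Pf; rewrite [RHS]/act_quad !(rep_act_quad q Pf). Qed.

Variable tau : F.

Definition level := {q : quad | moment q == tau%:M}.

Lemma act_level_subproof (f : symp_aut) (p : level) :
  moment (act_quad (val p) (val f)) == tau%:M.
Proof. by rewrite (moment_act _ (autRcP f)) (valP p). Qed.
Definition act_level (p : level) (f : symp_aut) : level :=
  exist _ (act_quad (val p) (val f)) (act_level_subproof f p).

Definition gl_rel (p q : level) : bool :=
  `[< exists2 g, g \in unitmx & val q = gl_act g (val p) >].

Lemma gl_act1 q : gl_act 1%:M q = q.
Proof.
by rewrite /gl_act invmx1 !(mul1mx, mulmx1); case: q => [[[? ?] ?] ?].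
Qed.

Lemma gl_actM g h q : g \in unitmx -> h \in unitmx ->
  gl_act (g *m h) q = gl_act g (gl_act h q).
Proof.
move=> ug uh; rewrite /gl_act /qA /qB /qi /qj /=.
have -> : invmx (g *m h) = invmx h *m invmx g.
  have u : g *m h \in unitmx by rewrite unitmx_mul ug.
  by rewrite -[RHS]mulmx1 -(mulmxV u) !mulmxA (mulmxKV ug) mulVmx // mul1mx.
by rewrite !mulmxA.
Qed.

Lemma gl_rel_refl : reflexive gl_rel.
Proof. by move=> p; apply/asboolP; exists 1%:M; rewrite ?unitmx1 ?gl_act1. Qed.

Lemma gl_rel_sym : symmetric gl_rel.
Proof.
suff h (p r : level) : gl_rel p r -> gl_rel r p by move=> p r; apply/idP/idP; apply: h.
move=> /asboolP [g ug e]; apply/asboolP; exists (invmx g); first by rewrite unitmx_inv.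
by rewrite e -gl_actM ?unitmx_inv // mulVmx // gl_act1.
Qed.

Lemma gl_rel_trans : transitive gl_rel.
Proof.
move=> q p r /asboolP [g ug e] /asboolP [h uh e']; apply/asboolP.
by exists (h *m g); rewrite ?unitmx_mul ?uh // e' e gl_actM.
Qed.

Canonical gl_equiv := EquivRel gl_rel gl_rel_refl gl_rel_sym gl_rel_trans.

(* The set of points of the quotient of the level set of [moment] by GL_k. *)
Definition NV : Type := {eq_quot gl_rel}.
Definition toN (p : level) : NV := \pi_({eq_quot gl_rel}) p.
Definition ofN (n : NV) : level := repr (n : {eq_quot gl_rel}).

(* Independent of the chosen representative by [act_N_toN]. *)
Definition act_N (n : NV) (f : symp_aut) : NV := toN (act_level (ofN n) f).

Lemma ofNK n : toN (ofN n) = n.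
Proof. exact: reprK. Qed.

Lemma toN_eq (p r : level) : toN p = toN r <-> gl_rel p r.
Proof. by split=> [/eqmodP|h] //; apply/eqmodP. Qed.

Lemma act_N_toN p f : act_N (toN p) f = toN (act_level p f).
Proof.
apply/toN_eq; have /toN_eq/asboolP [g ug e] := ofNK (toN p).
by apply/asboolP; exists g => //; rewrite /= e act_quad_gl.
Qed.

Lemma act_N1 n : act_N n 1%g = n.
Proof.
by rewrite -[n]ofNK act_N_toN; congr toN; apply: val_inj; rewrite /= act_quad_id.
Qed.

Lemma act_NM n (f h : symp_aut) : act_N n (f * h)%g = act_N (act_N n f) h.
Proof.
rewrite -[n]ofNK !act_N_toN; congr toN; apply: val_inj => /=.
by rewrite act_quad_comp //; case: (autRcP f).
Qed.

Definition symp_aut_action : right_action symp_aut NV :=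
  RightAction act_N1 act_NM.

End Action.

(* Main.v *)
Require Import Defs.
From HB Require Import structures.
From mathcomp Require Import all_boot all_order all_algebra.
From mathcomp Require Import boolp reals complex.
From mathcomp Require Import ring.

Set Implicit Arguments.
Unset Strict Implicit.
Unset Printing Implicit Defensive.

Import GRing.Theory Num.Theory.
Local Open Scope ring_scope.

(** Write a point as matrices [A], [B], columns [i1], [i2] and rows [j1], [j2]
    with [[A, B] = tau + i1 j1 + i2 j2].  Every point is moved, by automorphisms
    and base changes, to a normal form in which [A] is a nilpotent shift [S],
    [i1] is its first basis vector, and [i2] and [j2] vanish; two such points
    differ by a polynomial in [S] added to [B], which is again the effect of an
    automorphism ([reach_normal], [conn_normal]).

    The automorphisms used are the quarter turn of [a] and [a^*], the exchange of
    the indices 1 and 2, and the triangular maps with potentials [a^n] and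
    [a^n x y].  The last ones, conjugated by the others, make it possible to
    shear [(i1, i2)], to add [p(A) i1] to [i2], to replace [A] by [A + r i1 j2]
    (a feedback) with [i1] and [j2] fixed, and, when [i2 = 0], to add
    [j1 p(A + s B)] to [j2] with all the rest fixed.

    The hard step is to make [i1] a cyclic vector of [A] ([reach_cyclic]).
    Consider the functional [L P = j2 P(A) i1] on polynomials, and a point where
    the rank of its Hankel form [(f, g) |-> L (f g)] is largest.  A polynomial
    family of forms of rank at most [m] has derivatives vanishing on the kernel
    of a member of rank [m] ([hankel_border]).  Applied to the shears and to the
    moves with potential [a^* b], for the several cycles [b] of length two,
    this gives linear and quadratic relations on the multiples [P] of a high
    power of a polynomial [C] in the kernel.  With the moment equation they
    collapse to [tau^2 tr P'(A) = 0] ([trace_deriv0]).  In characteristic zero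
    this forces all eigenvalues of [A] to be roots of [C].  The same applies
    after the feedback [A + i1 j2], and if [i1] were not cyclic, an eigenvalue
    on the quotient by the space that [i1] generates would be a common root of
    both minimal annihilators, which is impossible.

    Once [i1] is cyclic, [i2] can be removed.  Then the rows [j1 (A + s B)^n]
    span all rows: their common kernel is stable under [A] and [B], and
    [[A, B] = tau] on it, so its dimension is zero as [tau <> 0]
    ([killed_eq0]).  Hence [j2] can be chosen at will; the feedback that makes
    [A] nilpotent (pole placement, [horner_basis]) leads to the normal form. *)

(** * Endomorphisms of a path algebra *)

Section PathHom.
Variables (F : fieldType) (Q : quiver).
Local Notation A := (path_algebra F Q).

Lemma vtxM (v w : vert Q) : vtx F v * vtx F w = if v == w then vtx F v else 0.
Proof.
rewrite /vtx palg_mulUUE /pathmul pcat_trivl.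
by rewrite [ptgt (ptriv w)]/=; have [->|] := eqVneq v w.
Qed.

Lemma algmor_ext (f g : A -> A) : linear f -> linear g ->
  {morph f : u v / u * v} -> {morph g : u v / u * v} -> f 1 = 1 -> g 1 = 1 ->
  (forall v, f (vtx F v) = g (vtx F v)) -> (forall b, f (arw F b) = g (arw F b)) ->
  f =1 g.
Proof.
move=> lf lg fM gM f1 g1 fgv fga; apply: (@linear_ext F Q A f g lf lg) => p.
rewrite palg_prodE fM gM fgv; congr (_ * _).
by elim: (parrs p) => [|b s IH]; rewrite ?big_nil ?f1 ?g1 // !big_cons fM gM fga IH.
Qed.

Variable m : arr Q -> A.

(** The algebra endomorphism that sends each arrow [b] to [m b] and fixes the
    trivial paths; [m b] has to run between the end points of [b]. *)
Definition phom_path (p : qpath Q) : A := vtx F (ptgt p) * \prod_(b <- parrs p) m b.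
Definition phom : A -> A := linext phom_path.
HB.instance Definition _ := GRing.Linear.on phom.

Hypothesis m_tgt : forall b, vtx F (tgt b) * m b = m b.
Hypothesis m_src : forall b, m b * vtx F (src b) = m b.

Lemma phom_linear : linear phom. Proof. exact: linearP. Qed.

Lemma phom_basis p : phom (pbasis F p) = phom_path p.
Proof. exact: linextU. Qed.

Lemma phom_vtx v : phom (vtx F v) = vtx F v.
Proof. by rewrite phom_basis /phom_path big_nil mulr1. Qed.

Lemma phom_arw b : phom (arw F b) = m b.
Proof. by rewrite phom_basis /phom_path big_seq1 m_tgt. Qed.

Lemma phom1 : phom 1 = 1.
Proof. by rewrite -[1]/(palg_one _ _) linear_sum; apply: eq_bigr => v _; exact: phom_vtx. Qed.

Lemma phom_path_src p : phom_path p * vtx F (psrc p) = phom_path p.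
Proof.
case: p => -[t s] ps; rewrite /phom_path /psrc /ptgt /parrs /=.
elim: s t ps => [|b s IH] t /=; first by rewrite big_nil mulr1 vtxM eqxx.
case/andP=> _ /IH; rewrite -mulrA big_cons => e.
by rewrite -[m b]m_src -!mulrA e.
Qed.

Lemma phom_pathM p q : phom (pathmul F p q) = phom_path p * phom_path q.
Proof.
rewrite /pathmul; have [e|ne] := eqVneq (psrc p) (ptgt q).
  have [r -> vr] := pcat_some e.
  rewrite [phom_path q]/phom_path -e mulrA phom_path_src.
  by rewrite phom_basis /phom_path /ptgt [parrs r]/parrs vr /= big_cat mulrA.
rewrite (pcat_none ne) linear0 -[phom_path p]phom_path_src -mulrA [phom_path q]/phom_path.
by rewrite [vtx _ _ * (_ * _)]mulrA vtxM (negbTE ne) mul0r mulr0.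
Qed.

Lemma phomM : {morph phom : u v / u * v}.
Proof.
move=> u v; move: v; apply: (@linear_ext F Q A).
- by move=> a x y; rewrite mulrDr -palg_scalerAr linearP.
- by move=> a x y; rewrite linearP mulrDr palg_scalerAr.
move=> q; move: u; apply: (@linear_ext F Q A).
- by move=> a x y; rewrite mulrDl -palg_scalerAl linearP.
- by move=> a x y; rewrite linearP mulrDl palg_scalerAl.
by move=> p; rewrite palg_mulUUE phom_pathM !phom_basis.
Qed.

End PathHom.

Section PathAut.
Variables (F : fieldType) (Q : quiver).
Local Notation A := (path_algebra F Q).

Lemma phomK (m m' : arr Q -> A)
  (m_tgt : forall b, vtx F (tgt b) * m b = m b)
  (m_src : forall b, m b * vtx F (src b) = m b)
  (m'_tgt : forall b, vtx F (tgt b) * m' b = m' b)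
  (m'_src : forall b, m' b * vtx F (src b) = m' b) :
  (forall b, phom m' (m b) = arw F b) -> cancel (phom m) (phom m').
Proof.
move=> mK; apply: (@algmor_ext F Q (phom m' \o phom m) id) => //=.
- by move=> a u v /=; rewrite !linearP.
- by move=> u v /=; rewrite !phomM.
- by rewrite !phom1.
- by move=> v; rewrite !phom_vtx.
- by move=> b; rewrite phom_arw.
Qed.

Lemma phom_autRc (m m' : arr Q -> A) (c : A)
  (m_tgt : forall b, vtx F (tgt b) * m b = m b)
  (m_src : forall b, m b * vtx F (src b) = m b)
  (m'_tgt : forall b, vtx F (tgt b) * m' b = m' b)
  (m'_src : forall b, m' b * vtx F (src b) = m' b) :
  (forall b, phom m' (m b) = arw F b) -> (forall b, phom m (m' b) = arw F b) ->
  phom m c = c -> is_autRc c (phom m).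
Proof.
move=> mK m'K mc; split=> //; split.
- exact: phom_linear.
- exact: phom1.
- exact: phomM.
- by exists (phom m'); apply: phomK.
- by move=> r; rewrite linear_sum; apply: eq_bigr => v _; rewrite linearZ /= phom_vtx.
Qed.
End PathAut.

Lemma telescope_comm (R : pzRingType) (x w y : R) n :
  \sum_(l < n) x ^+ l * (x * w - w * y) * y ^+ (n - l.+1) = x ^+ n * w - w * y ^+ n.
Proof.
pose f l := x ^+ l * w * y ^+ (n - l).
have -> : \sum_(l < n) x ^+ l * (x * w - w * y) * y ^+ (n - l.+1) = \sum_(l < n) (f l.+1 - f l).
  apply: eq_bigr => l _; rewrite mulrBr mulrBl /f; congr (_ - _).
    by rewrite exprSr !mulrA.
  by rewrite -(subnSK (ltn_ord l)) exprS !mulrA.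
rewrite -(big_mkord xpredT (fun l => f l.+1 - f l)) telescope_sumr //.
by rewrite /f subnn subn0 !expr0 mulr1 mul1r.
Qed.

(** * Four families of symplectic automorphisms *)

Section Generators.
Variable F : fieldType.
Local Notation DQ := (Defs.double bp_quiver).
Local Notation PA := (path_algebra F DQ).
Local Notation a := (bpa F).
Local Notation x := (bpx F).
Local Notation y := (bpy F).
Local Notation a' := (bpa' F).
Local Notation x' := (bpx' F).
Local Notation y' := (bpy' F).

Local Notation e1 := (vtx F (V1 : vert DQ)).
Local Notation e2 := (vtx F (V2 : vert DQ)).

Definition arw_map (xa xx xy xa' xx' xy' : PA) (b : arr DQ) : PA :=
  match b with
  | inl Arr_a => xa | inl Arr_x => xx | inl Arr_y => xy
  | inr Arr_a => xa' | inr Arr_x => xx' | inr Arr_y => xy'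
  end.

Lemma vtx_bp :
  ((e1 * a = a)%R * (a * e1 = a)%R * (e1 * a' = a')%R * (a' * e1 = a')%R *
   (e1 * x = x)%R * (x * e2 = x)%R * (e2 * x' = x')%R * (x' * e1 = x')%R *
   (e2 * y = y)%R * (y * e1 = y)%R * (e1 * y' = y')%R * (y' * e2 = y')%R)%type.
Proof.
have t b := @vtx_arw F DQ b; have s b := @arw_vtx F DQ b.
do !split;
  [ exact: (t (inl Arr_a)) | exact: (s (inl Arr_a)) | exact: (t (inr Arr_a))
  | exact: (s (inr Arr_a)) | exact: (t (inl Arr_x)) | exact: (s (inl Arr_x))
  | exact: (t (inr Arr_x)) | exact: (s (inr Arr_x)) | exact: (t (inl Arr_y))
  | exact: (s (inl Arr_y)) | exact: (t (inr Arr_y)) | exact: (s (inr Arr_y)) ].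
Qed.

Lemma comm_e1 n : e1 * a ^+ n = a ^+ n * e1.
Proof. by apply: commrX; rewrite /GRing.comm !vtx_bp. Qed.

Lemma ae1 n : a ^+ n.+1 * e1 = a ^+ n.+1.
Proof. by rewrite exprSr -mulrA vtx_bp. Qed.

Lemma phomX (m : arr DQ -> PA)
  (m_tgt : forall b, vtx F (tgt b) * m b = m b)
  (m_src : forall b, m b * vtx F (src b) = m b) u n :
  phom m (u ^+ n) = phom m u ^+ n.
Proof. by elim: n => [|n IH]; rewrite ?phom1 // !exprS phomM // IH. Qed.


Lemma phom_comm (m : arr DQ -> PA)
  (m_tgt : forall b, vtx F (tgt b) * m b = m b)
  (m_src : forall b, m b * vtx F (src b) = m b) u v :
  phom m (comm_br u v) = comm_br (phom m u) (phom m v).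
Proof. by rewrite /comm_br linearB /= !phomM. Qed.

Lemma phom_bpc (m : arr DQ -> PA)
  (m_tgt : forall b, vtx F (tgt b) * m b = m b)
  (m_src : forall b, m b * vtx F (src b) = m b) :
  phom m (bpc F) = comm_br (m (inl Arr_a)) (m (inr Arr_a)) +
    comm_br (m (inl Arr_x)) (m (inr Arr_x)) + comm_br (m (inl Arr_y)) (m (inr Arr_y)).
Proof. by rewrite /bpc 2!linearD /= !phom_comm // !(phom_arw m_tgt). Qed.

Lemma comm_brDZ (u v w : PA) c : comm_br u (v + c *: w) = comm_br u v + c *: comm_br u w.
Proof.
rewrite /comm_br mulrDr mulrDl -palg_scalerAr -palg_scalerAl scalerBr.
by rewrite opprD addrACA.
Qed.


(** Each of the maps below is the flow of a cyclic potential, or a linear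
    symplectic map.  The potential of this one is a power of [a]; the vertex
    idempotent keeps the constant term [n = 0] at the first vertex. *)
Definition addpow_map (c : F) n := arw_map a x y (a' + c *: (e1 * a ^+ n)) x' y'.

Lemma addpow_tgt c n b : vtx F (tgt b) * addpow_map c n b = addpow_map c n b.
Proof.
case: b => -[] /=; rewrite ?vtx_bp //.
by rewrite mulrDr -palg_scalerAr vtx_bp mulrA vtxM eqxx.
Qed.
Lemma addpow_src c n b : addpow_map c n b * vtx F (src b) = addpow_map c n b.
Proof.
case: b => -[] /=; rewrite ?vtx_bp //.
by rewrite mulrDl -palg_scalerAl vtx_bp -mulrA -comm_e1 mulrA vtxM eqxx.
Qed.

Lemma addpowK c n b : phom (addpow_map (- c) n) (addpow_map c n b) = arw F b.
Proof.
have [t s] := (addpow_tgt (- c) n, addpow_src (- c) n).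
case: b => -[] /=; rewrite ?(phom_arw t) //=.
rewrite linearD linearZ /= phomM // phomX // phom_vtx !(phom_arw t) /=.
by rewrite scaleNr subrK.
Qed.

Lemma addpow_bpc c n : phom (addpow_map c n) (bpc F) = bpc F.
Proof.
rewrite (phom_bpc (addpow_tgt c n) (addpow_src c n)) /= comm_brDZ.
suff -> : comm_br a (e1 * a ^+ n) = 0 by rewrite scaler0 addr0.
by rewrite /comm_br comm_e1 mulrA -exprS -mulrA vtx_bp -exprSr ae1 subrr.
Qed.
Lemma addpow_aut (c : F) n : is_autRc (bpc F) (phom (addpow_map c n)).
Proof.
apply: (@phom_autRc F DQ _ (addpow_map (- c) n)).
- exact: addpow_tgt. - exact: addpow_src. - exact: addpow_tgt. - exact: addpow_src.
- exact: addpowK. - by move=> b; rewrite -{1}[c]opprK addpowK. - exact: addpow_bpc.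
Qed.

Definition rot_map (s : bool) :=
  if s then arw_map a' x y (- a) x' y' else arw_map (- a') x y a x' y'.
Lemma rot_tgt s b : vtx F (tgt b) * rot_map s b = rot_map s b.
Proof. by case: s; case: b => -[] /=; rewrite ?mulrN ?vtx_bp. Qed.
Lemma rot_src s b : rot_map s b * vtx F (src b) = rot_map s b.
Proof. by case: s; case: b => -[] /=; rewrite ?mulNr ?vtx_bp. Qed.
Lemma rotK s b : phom (rot_map (~~ s)) (rot_map s b) = arw F b.
Proof.
have t := rot_tgt (~~ s).
by case: b => -[]; case: s t => t /=; rewrite ?linearN /= (phom_arw t) //= opprK.
Qed.
Lemma rot_bpc : phom (rot_map true) (bpc F) = bpc F.
Proof.
rewrite (phom_bpc (rot_tgt true) (rot_src true)) /=.
suff -> : comm_br a' (- a) = comm_br a a' by [].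
by rewrite /comm_br mulNr mulrN opprK addrC.
Qed.
Lemma rot_aut : is_autRc (bpc F) (phom (rot_map true)).
Proof.
apply: (@phom_autRc F DQ _ (rot_map false)).
- exact: rot_tgt. - exact: rot_src. - exact: rot_tgt. - exact: rot_src.
- exact: (rotK true). - exact: (rotK false). - exact: rot_bpc.
Qed.

(** In terms of quadruples this exchanges the indices 1 and 2 of the columns
    and of the rows. *)
Definition swap_map := arw_map a (- y') x' a' y (- x).
Lemma swap_tgt b : vtx F (tgt b) * swap_map b = swap_map b.
Proof. by case: b => -[] /=; rewrite ?mulrN ?vtx_bp. Qed.
Lemma swap_src b : swap_map b * vtx F (src b) = swap_map b.
Proof. by case: b => -[] /=; rewrite ?mulNr ?vtx_bp. Qed.
Lemma swapK b : phom swap_map (swap_map b) = arw F b.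
Proof.
have t := swap_tgt.
by case: b => -[] /=; rewrite ?linearN /= ?(phom_arw t) //= opprK.
Qed.
Lemma swap_bpc : phom swap_map (bpc F) = bpc F.
Proof.
rewrite (phom_bpc swap_tgt swap_src) /=.
have -> : comm_br (- y') y = comm_br y y' by rewrite /comm_br mulNr mulrN opprK addrC.
have -> : comm_br x' (- x) = comm_br x x' by rewrite /comm_br mulNr mulrN opprK addrC.
by rewrite /bpc addrAC.
Qed.
Lemma swap_aut : is_autRc (bpc F) (phom swap_map).
Proof.
apply: (@phom_autRc F DQ _ swap_map).
- exact: swap_tgt. - exact: swap_src. - exact: swap_tgt. - exact: swap_src.
- exact: swapK. - exact: swapK. - exact: swap_bpc.
Qed.

(** The derivatives of the cyclic potential [a^n x y] with respect to [a], [x]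
    and [y] are [cycle_deriv n], [y a^n] and [a^n x].  Adding these multiples to the
    three starred arrows preserves [c], since the sum of the commutators of the
    variables with the derivatives of a cyclic word vanishes. *)
Definition cycle_deriv n : PA := \sum_(l < n) a ^+ l * (x * y) * a ^+ (n - l.+1).
Definition cycle_map (c : F) n :=
  arw_map a x y (a' + c *: cycle_deriv n) (x' + c *: (y * a ^+ n)) (y' + c *: (a ^+ n * x)).

Lemma cycle_tgt c n b : vtx F (tgt b) * cycle_map c n b = cycle_map c n b.
Proof.
case: b => -[] /=; rewrite ?vtx_bp //; rewrite mulrDr -palg_scalerAr vtx_bp.
- congr (_ + _ *: _); rewrite mulr_sumr; apply: eq_bigr => l _.
  by rewrite !mulrA comm_e1 -[_ * e1 * x]mulrA vtx_bp.
- by rewrite mulrA vtx_bp.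
- by rewrite mulrA comm_e1 -mulrA vtx_bp.
Qed.
Lemma cycle_src c n b : cycle_map c n b * vtx F (src b) = cycle_map c n b.
Proof.
case: b => -[] /=; rewrite ?vtx_bp //; rewrite mulrDl -palg_scalerAl vtx_bp.
- congr (_ + _ *: _); rewrite mulr_suml; apply: eq_bigr => l _.
  by rewrite -!mulrA -comm_e1 [y * (e1 * _)]mulrA vtx_bp.
- by rewrite -mulrA -comm_e1 mulrA vtx_bp.
- by rewrite -mulrA vtx_bp.
Qed.
Lemma cycle_derivE c n k : phom (cycle_map c n) (cycle_deriv k) = cycle_deriv k.
Proof.
have [t s] := (cycle_tgt c n, cycle_src c n).
rewrite linear_sum /=; apply: eq_bigr => l _.
by rewrite !phomM // !phomX // !(phom_arw t).
Qed.
Lemma cycleK c n b : phom (cycle_map (- c) n) (cycle_map c n b) = arw F b.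
Proof.
have [t s] := (cycle_tgt (- c) n, cycle_src (- c) n).
case: b => -[] /=; rewrite ?(phom_arw t) //=; rewrite linearD linearZ /=
  ?cycle_derivE ?phomM // ?phomX // !(phom_arw t) /=;
by rewrite scaleNr subrK.
Qed.
Lemma cycle_deriv_comm n : comm_br a (cycle_deriv n) = a ^+ n * (x * y) - x * y * a ^+ n.
Proof.
rewrite -telescope_comm /comm_br /cycle_deriv mulr_sumr mulr_suml -sumrB.
apply: eq_bigr => l _; rewrite mulrBr mulrBl; congr (_ - _).
  by rewrite !mulrA -exprS -exprSr.
by rewrite -[LHS]mulrA -exprSr exprS !mulrA.
Qed.
Lemma cycle_bpc c n : phom (cycle_map c n) (bpc F) = bpc F.
Proof.
rewrite (phom_bpc (cycle_tgt c n) (cycle_src c n)) /= !comm_brDZ cycle_deriv_comm.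
rewrite [X in X + _ = _]addrACA [LHS]addrACA -!scalerDr.
suff -> : a ^+ n * (x * y) - x * y * a ^+ n + comm_br x (y * a ^+ n)
   + comm_br y (a ^+ n * x) = 0 by rewrite scaler0 addr0.
by rewrite /comm_br !mulrA !addrA !subrK subrr.
Qed.

Lemma cycle_aut (c : F) n : is_autRc (bpc F) (phom (cycle_map c n)).
Proof.
apply: (@phom_autRc F DQ _ (cycle_map (- c) n)).
- exact: cycle_tgt. - exact: cycle_src. - exact: cycle_tgt. - exact: cycle_src.
- exact: cycleK. - by move=> b; rewrite -{1}[c]opprK cycleK. - exact: cycle_bpc.
Qed.

End Generators.

(** * The action on quadruples *)

Section Moves.
Variables (F : fieldType) (k : nat).
Local Notation DQ := (Defs.double bp_quiver).
Local Notation PA := (path_algebra F DQ).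
Local Notation quad := (quad F k).
Implicit Types (q : quad) (A B : 'M[F]_k) (i u : 'cV[F]_k) (j v : 'rV[F]_k) (c : F).

Definition mkq A B i1 i2 j1 j2 : quad := (A, B, row_mx i1 i2, col_mx j1 j2).

Lemma mkqE q : q = mkq (qA q) (qB q) (qi1 q) (qi2 q) (qj1 q) (qj2 q).
Proof.
by rewrite /mkq /qi1 /qi2 /qj1 /qj2 hsubmxK vsubmxK; case: q => [[[? ?] ?] ?].
Qed.

Lemma qi1_mkq A B i1 i2 j1 j2 : qi1 (mkq A B i1 i2 j1 j2) = i1.
Proof. exact: row_mxKl. Qed.
Lemma qi2_mkq A B i1 i2 j1 j2 : qi2 (mkq A B i1 i2 j1 j2) = i2.
Proof. exact: row_mxKr. Qed.
Lemma qj1_mkq A B i1 i2 j1 j2 : qj1 (mkq A B i1 i2 j1 j2) = j1.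
Proof. exact: col_mxKu. Qed.
Lemma qj2_mkq A B i1 i2 j1 j2 : qj2 (mkq A B i1 i2 j1 j2) = j2.
Proof. exact: col_mxKd. Qed.
Definition mkqK := (qi1_mkq, qi2_mkq, qj1_mkq, qj2_mkq).

Lemma moment_mkq A B i1 i2 j1 j2 : moment (mkq A B i1 i2 j1 j2) =
  A *m B - B *m A - (i1 *m j1 + i2 *m j2).
Proof. by rewrite /moment /mkq /qi /qj /= mul_row_col. Qed.

(** Two points of a level set have the same class modulo automorphisms in the
    quotient exactly when they are related in this way; working with
    quadruples up to [conn] avoids the quotient until the very end. *)
Definition conn q q' : Prop := exists f g,
  [/\ is_autRc (bpc F) f, g \in unitmx & q' = gl_act g (act_quad q f)].

Lemma conn_aut q f : is_autRc (bpc F) f -> conn q (act_quad q f).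
Proof. by move=> Pf; exists f, 1%:M; rewrite unitmx1 gl_act1. Qed.

Lemma conn_gl q g : g \in unitmx -> conn q (gl_act g q).
Proof. by move=> ug; exists id, g; rewrite act_quad_id; split=> //; apply: is_autRc_id. Qed.

Lemma conn_refl q : conn q q.
Proof. by rewrite -{2}[q]gl_act1; apply: conn_gl; rewrite unitmx1. Qed.

Lemma conn_trans q1 q2 q3 : conn q1 q2 -> conn q2 q3 -> conn q1 q3.
Proof.
move=> [f [g [Pf ug ->]]] [f' [g' [Pf' ug' ->]]].
exists (f \o f'), (g' *m g); split; first exact: is_autRc_comp.
  by rewrite unitmx_mul ug'.
by rewrite act_quad_gl // act_quad_comp ?gl_actM //; case: Pf.
Qed.

Lemma conn_sym q1 q2 : conn q1 q2 -> conn q2 q1.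
Proof.
move=> [f [g [Pf ug ->]]].
have [[lf f1 fM [h fK hK] fR] fc] := Pf.
have Ph := is_autRc_inv Pf fK hK.
exists h, (invmx g); rewrite unitmx_inv; split=> //.
rewrite act_quad_gl // -gl_actM ?unitmx_inv // mulVmx // gl_act1 -act_quad_comp; last by case: Pf.
have -> : f \o h = id by apply/funext => u /=; rewrite hK.
by rewrite act_quad_id.
Qed.

Lemma conn_moment q q' t : conn q q' -> moment q = t%:M -> moment q' = t%:M.
Proof.
move=> [f [g [Pf ug ->]]] e.
by rewrite moment_gl // (moment_act q Pf) e mul_mx_scalar -scalemxAl mulmxV // scalemx1.
Qed.

Lemma rep_e1aX q n : rep q (vtx F (V1 : vert DQ) * bpa F ^+ n) = block_mx (qA q ^+ n) 0 0 0.
Proof.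
elim: n => [|n IH]; first by rewrite !expr0 mulr1 rep_vtx.
rewrite exprSr mulrA repM IH rep_arw /= -mulmxE mulmx_block.
by rewrite !(mulmx0, mul0mx, addr0, add0r) exprSr.
Qed.

Lemma rep_aXx q n : rep q (bpa F ^+ n * bpx F) = block_mx 0 (- (qA q ^+ n *m qi1 q)) 0 0.
Proof.
elim: n => [|n IH]; first by rewrite !expr0 mul1r rep_arw /= -idmxE mul1mx.
rewrite exprS -mulrA repM IH rep_arw /= -mulmxE mulmx_block.
by rewrite !(mulmx0, mul0mx, addr0, add0r) mulmxN exprS -mulmxE mulmxA.
Qed.

Lemma rep_yaX q n : rep q (bpy F * bpa F ^+ n) = block_mx 0 0 (qj2 q *m qA q ^+ n) 0.
Proof.
elim: n => [|n IH]; first by rewrite !expr0 mulr1 rep_arw /= -idmxE mulmx1.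
rewrite exprSr mulrA repM IH rep_arw /= -mulmxE mulmx_block.
by rewrite !(mulmx0, mul0mx, addr0, add0r) exprSr -mulmxE mulmxA.
Qed.

Lemma repDZ q c (s w : PA) : rep q (s + c *: w) = rep q s + c *: rep q w.
Proof. by rewrite linearD linearZ. Qed.

(** The derivative of [A |-> A ^+ n] in the direction [X]. *)
Definition dpow A (X : 'M[F]_k) n := \sum_(l < n) A ^+ l *m X *m A ^+ (n - l.+1).

Lemma rep_cycle_deriv q n :
  ulsubmx (rep q (cycle_deriv F n)) = - dpow (qA q) (qi1 q *m qj2 q) n.
Proof.
rewrite /cycle_deriv /dpow linear_sum /= -sumrN.
have ulsum I r (f : I -> 'M[F]_(k + 1)) :
    ulsubmx (\sum_(l <- r) f l) = \sum_(l <- r) ulsubmx (f l).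
  by apply/matrixP => s t; rewrite !mxE !summxE; apply: eq_bigr => l _; rewrite !mxE.
rewrite ulsum; apply: eq_bigr => l _; rewrite mulrA -[_ * _ * _]mulrA repM rep_aXx rep_yaX.
rewrite -mulmxE mulmx_block !(mulmx0, mul0mx, addr0, add0r).
by rewrite block_mxKul mulNmx !mulmxA.
Qed.

Lemma act_quadE q f Ra Ra' Rx Rx' Ry Ry' :
  rep q (f (bpa F)) = Ra -> rep q (f (bpa' F)) = Ra' ->
  rep q (f (bpx F)) = Rx -> rep q (f (bpx' F)) = Rx' ->
  rep q (f (bpy F)) = Ry -> rep q (f (bpy' F)) = Ry' ->
  act_quad q f = mkq (ulsubmx Ra) (ulsubmx Ra') (- ursubmx Rx) (ursubmx Ry')
    (dlsubmx Rx') (dlsubmx Ry).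
Proof. by move=> <- <- <- <- <- <-. Qed.

Lemma ulsubmxDZ c (X Y : 'M[F]_(k + 1)) : ulsubmx (X + c *: Y) = ulsubmx X + c *: ulsubmx Y.
Proof. by apply/matrixP => r s; rewrite !mxE. Qed.
Lemma ursubmxDZ c (X Y : 'M[F]_(k + 1)) : ursubmx (X + c *: Y) = ursubmx X + c *: ursubmx Y.
Proof. by apply/matrixP => r s; rewrite !mxE. Qed.
Lemma dlsubmxDZ c (X Y : 'M[F]_(k + 1)) : dlsubmx (X + c *: Y) = dlsubmx X + c *: dlsubmx Y.
Proof. by apply/matrixP => r s; rewrite !mxE. Qed.

Lemma conn_addpow c n A B i1 i2 j1 j2 :
  conn (mkq A B i1 i2 j1 j2) (mkq A (B + c *: A ^+ n) i1 i2 j1 j2).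
Proof.
set q := mkq A _ _ _ _ _.
suff -> : mkq A (B + c *: A ^+ n) i1 i2 j1 j2 = act_quad q (phom (addpow_map c n)).
  exact: conn_aut (addpow_aut c n).
rewrite /act_quad !(phom_arw (@addpow_tgt F c n)) /=; rewrite repDZ rep_e1aX !rep_arw /=.
rewrite scale_block_mx add_block_mx !block_mxKul !block_mxKur !block_mxKdl.
by rewrite opprK !mkqK.
Qed.

Lemma conn_rot A B i1 i2 j1 j2 :
  conn (mkq A B i1 i2 j1 j2) (mkq B (- A) i1 i2 j1 j2).
Proof.
set q := mkq A _ _ _ _ _.
suff -> : mkq B (- A) i1 i2 j1 j2 = act_quad q (phom (rot_map F true)).
  exact: conn_aut (rot_aut F).
rewrite /act_quad !(phom_arw (@rot_tgt F true)) /=; rewrite linearN /= !rep_arw /=.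
rewrite opp_block_mx !block_mxKul !block_mxKur !block_mxKdl.
by rewrite opprK !mkqK.
Qed.

Lemma conn_cycle c n A B i1 i2 j1 j2 :
  conn (mkq A B i1 i2 j1 j2)
   (mkq A (B - c *: dpow A (i1 *m j2) n) i1 (i2 - c *: (A ^+ n *m i1))
      (j1 + c *: (j2 *m A ^+ n)) j2).
Proof.
set q := mkq A _ _ _ _ _.
suff -> : mkq A (B - c *: dpow A (i1 *m j2) n) i1 (i2 - c *: (A ^+ n *m i1))
      (j1 + c *: (j2 *m A ^+ n)) j2 = act_quad q (phom (cycle_map c n)).
  exact: conn_aut (cycle_aut c n).
have ph b := phom_arw (@cycle_tgt F c n) b.
symmetry; apply: etrans.
  apply: act_quadE.
  - by rewrite (ph (inl Arr_a)) /= rep_arw.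
  - by rewrite (ph (inr Arr_a)) /= repDZ rep_arw.
  - by rewrite (ph (inl Arr_x)) /= rep_arw.
  - by rewrite (ph (inr Arr_x)) /= repDZ rep_arw rep_yaX.
  - by rewrite (ph (inl Arr_y)) /= rep_arw.
  - by rewrite (ph (inr Arr_y)) /= repDZ rep_arw rep_aXx.
rewrite /bpM ulsubmxDZ ursubmxDZ dlsubmxDZ rep_cycle_deriv.
by rewrite !block_mxKul !block_mxKur !block_mxKdl opprK !scalerN !mkqK.
Qed.

Lemma conn_swap A B i1 i2 j1 j2 :
  conn (mkq A B i1 i2 j1 j2) (mkq A B i2 i1 j2 j1).
Proof.
set q := mkq A _ _ _ _ _.
suff -> : mkq A B i2 i1 j2 j1 = act_quad q (phom (swap_map F)).
  exact: conn_aut (swap_aut F).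
rewrite /act_quad !(phom_arw (@swap_tgt F)) /=; rewrite !linearN /= !rep_arw /=.
rewrite !opp_block_mx !block_mxKul !block_mxKur !block_mxKdl.
by rewrite !opprK !mkqK.
Qed.

End Moves.

(** * Linear functionals on polynomials *)

Section Moments.
Variable F : fieldType.
Implicit Types (mu nu : nat -> F) (P Q f g : {poly F}).

(** The linear functional on polynomials with moments [mu n] at ['X^n]. *)
Definition mom mu P : F := \sum_(i < size P) P`_i * mu i.

Lemma momEw mu P N : (size P <= N)%N -> mom mu P = \sum_(i < N) P`_i * mu i.
Proof.
move=> le; rewrite /mom (big_ord_widen N (fun i => P`_i * mu i)) // big_mkcond.
by apply: eq_bigr => i _; case: ltnP => // ge; rewrite nth_default ?mul0r.
Qed.

Lemma mom_is_linear mu : scalar (mom mu).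
Proof.
move=> c P Q; pose N := (maxn (size P) (maxn (size Q) (size (c *: P + Q)%R))).
have hP : (size P <= N)%N by rewrite leq_maxl.
have hQ : (size Q <= N)%N by rewrite leq_max leq_maxl orbT.
have hR : (size (c *: P + Q)%R <= N)%N by rewrite !leq_max leqnn !orbT.
rewrite (momEw mu hP) (momEw mu hQ) (momEw mu hR) mulr_sumr -big_split /=.
by apply: eq_bigr => i _; rewrite coefD coefZ mulrDl mulrA.
Qed.
HB.instance Definition _ mu := GRing.isLinear.Build F {poly F} F *%R (mom mu) (mom_is_linear mu).

Lemma eq_mom mu nu P : mu =1 nu -> mom mu P = mom nu P.
Proof. by move=> e; apply: eq_bigr => i _; rewrite e. Qed.

Lemma momDl mu nu P : mom (fun n => mu n + nu n) P = mom mu P + mom nu P.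
Proof. by rewrite -big_split; apply: eq_bigr => i _; rewrite mulrDr. Qed.

Lemma momZl c mu P : mom (fun n => c * mu n) P = c * mom mu P.
Proof. by rewrite mulr_sumr; apply: eq_bigr => i _; rewrite mulrCA. Qed.

Lemma momXn mu n : mom mu 'X^n = mu n.
Proof.
rewrite /mom size_polyXn big_ord_recr /= coefXn eqxx mul1r big1 ?add0r // => i _.
by rewrite coefXn (ltn_eqF (ltn_ord i)) mul0r.
Qed.

Lemma mom_ext (h : {poly F} -> F) mu P :
  scalar h -> (forall n, h 'X^n = mu n) -> h P = mom mu P.
Proof.
move=> lh e; pose L := GRing.isLinear.Build F {poly F} F *%R h lh.
pose h' : {scalar {poly F}} := HB.pack h L.
rewrite -[P]coefK poly_def -[LHS]/(h' _) !linear_sum; apply: eq_bigr => i _.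
by rewrite !linearZ /= e momXn.
Qed.

(** The moments of the functional [P |-> mom mu (Q * P)]. *)
Definition shift_mom Q mu : nat -> F := fun n => mom mu (Q * 'X^n).

Lemma mom_shift Q mu P : mom (shift_mom Q mu) P = mom mu (Q * P).
Proof.
apply/esym; apply: (@mom_ext (fun P => mom mu (Q * P))) => // c f g.
by rewrite mulrDr -scalerAr linearP.
Qed.

(** [Q] lies in the kernel of the Hankel form [(f, g) |-> mom mu (f * g)]. *)
Definition ann mu Q := forall n, mom mu (Q * 'X^n) = 0.

Lemma ann_mom mu Q P : ann mu Q -> mom mu (Q * P) = 0.
Proof.
by move=> h; rewrite -mom_shift; apply: big1 => i _; rewrite /shift_mom h mulr0.
Qed.

Lemma ann_mulr mu Q P : ann mu Q -> ann mu (Q * P).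
Proof. by move=> h n; rewrite -mulrA ann_mom. Qed.

(** [mom (conv mu nu) P] is the value of [mu] on [s] and of [nu] on [t] at the
    divided difference [(P s - P t) / (s - t)]. *)
Definition conv mu nu : nat -> F := fun n => \sum_(l < n) mu l * nu (n - l.+1)%N.

Lemma conv_sym mu nu : conv mu nu =1 conv nu mu.
Proof.
move=> n; rewrite /conv (reindex_inj rev_ord_inj) /=; apply: eq_bigr => l _.
by rewrite mulrC; congr (_ * mu _); rewrite subnS subKn ?subSS //; case: l.
Qed.

Lemma conv_XX mu nu a b : conv mu nu (a + b)%N =
  conv (fun n => mu (a + n)%N) nu b + conv mu (fun n => nu (b + n)%N) a.
Proof.
rewrite /conv big_split_ord [LHS]addrC /=; congr (_ + _); apply: eq_bigr => l _ /=.
  by rewrite -addnS subnDl.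
by rewrite addnC addnBA.
Qed.

Lemma conv_linl c mu mu' nu P :
  mom (conv (fun n => c * mu n + mu' n) nu) P = c * mom (conv mu nu) P + mom (conv mu' nu) P.
Proof.
rewrite -momZl -momDl; apply: eq_mom => n; rewrite /conv mulr_sumr -big_split.
by apply: eq_bigr => l _; rewrite mulrDl mulrA.
Qed.

Lemma conv_linr c mu nu nu' P :
  mom (conv mu (fun n => c * nu n + nu' n)) P = c * mom (conv mu nu) P + mom (conv mu nu') P.
Proof.
rewrite (eq_mom _ (conv_sym _ _)) conv_linl.
by congr (_ * _ + _); apply/eq_mom/conv_sym.
Qed.

Lemma eq_conv mu mu' nu nu' : mu =1 mu' -> nu =1 nu' -> conv mu nu =1 conv mu' nu'.
Proof. by move=> e e' n; apply: eq_bigr => l _; rewrite e e'. Qed.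

(** The Leibniz rule for divided differences. *)
Lemma mom_conv_mul mu nu f g : mom (conv mu nu) (f * g) =
  mom (conv (shift_mom f mu) nu) g + mom (conv mu (shift_mom g nu)) f.
Proof.
have shiftP c (h h' : {poly F}) rho n :
    shift_mom (c *: h + h') rho n = c * shift_mom h rho n + shift_mom h' rho n.
  by rewrite /shift_mom mulrDl -scalerAl linearP.
have shiftX a rho n : shift_mom 'X^a rho n = rho (a + n)%N.
  by rewrite /shift_mom -exprD momXn.
pose rhs g f := mom (conv (shift_mom f mu) nu) g + mom (conv mu (shift_mom g nu)) f.
have rhs_lin h : scalar (rhs h).
  move=> c f1 f2; rewrite /rhs linearP (eq_mom _ (eq_conv (shiftP _ _ _ _) (frefl _))).
  by rewrite conv_linl mulrDr addrACA.
have mul_lin h : scalar (fun f => mom (conv mu nu) (f * h)).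
  by move=> c f1 f2; rewrite mulrDl -scalerAl linearP.
rewrite -[RHS]/(rhs g f) (mom_ext f (mul_lin g) (fun=> erefl)) (mom_ext f (rhs_lin g) (fun=> erefl)).
apply: eq_mom => a; rewrite /rhs.
have rhs_lin' : scalar (fun h => rhs h 'X^a).
  move=> c f1 f2; rewrite /rhs linearP (eq_mom _ (eq_conv (frefl _) (shiftP _ _ _ _))).
  by rewrite conv_linr mulrDr addrACA.
have mul_lin' : scalar (fun h => mom (conv mu nu) ('X^a * h)).
  by move=> c f1 f2; rewrite mulrDr -scalerAr linearP.
rewrite (mom_ext g mul_lin' (fun=> erefl)) -[RHS]/(rhs g 'X^a).
rewrite (mom_ext g rhs_lin' (fun=> erefl)).
apply: eq_mom => b; rewrite /rhs -exprD !momXn conv_XX.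
by congr (_ + _); apply: eq_conv => // n; rewrite shiftX.
Qed.

Lemma mom_conv_ann mu nu f g : ann mu f -> ann nu g -> mom (conv mu nu) (f * g) = 0.
Proof.
move=> hf hg; rewrite mom_conv_mul /mom !big1 ?addr0 // => n _.
  by rewrite /conv big1 ?mulr0 // => l _; rewrite [shift_mom _ _ _]hg mulr0.
by rewrite /conv big1 ?mulr0 // => l _; rewrite [shift_mom _ _ _]hf mul0r.
Qed.

(** The Hankel form of [mu] has rank at least [m].  The polynomials are
    arbitrary, which makes the notion insensitive to a change of the operator
    that does not change the spaces generated. *)
Definition hankel_ge m mu := exists p q : 'I_m -> {poly F},
  \det (\matrix_(a < m, b < m) mom mu (p a * q b)) != 0.

End Moments.

(** * Families depending polynomially on a parameter *)

Section PolyFun.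
Variable F : numFieldType.
Implicit Types (f g : F -> F).

Definition polyfun f := exists p : {poly F}, forall r, f r = p.[r].

Lemma polyfun_cst c : polyfun (fun=> c).
Proof. by exists c%:P => r; rewrite hornerC. Qed.
Lemma polyfun_id : polyfun id.
Proof. by exists 'X => r; rewrite hornerX. Qed.
Lemma polyfunD f g : polyfun f -> polyfun g -> polyfun (fun r => f r + g r).
Proof. by move=> [p hp] [q hq]; exists (p + q) => r; rewrite hornerD hp hq. Qed.
Lemma polyfunM f g : polyfun f -> polyfun g -> polyfun (fun r => f r * g r).
Proof. by move=> [p hp] [q hq]; exists (p * q) => r; rewrite hornerM hp hq. Qed.
Lemma polyfun_sum (I : Type) (s : seq I) (h : I -> F -> F) :
  (forall i, polyfun (h i)) -> polyfun (fun r => \sum_(i <- s) h i r).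
Proof.
move=> hh; elim: s => [|i s IH].
  by exists 0 => r; rewrite big_nil horner0.
have [p hp] := polyfunD (hh i) IH; exists p => r; by rewrite big_cons hp.
Qed.
Lemma polyfun_prod (I : Type) (s : seq I) (h : I -> F -> F) :
  (forall i, polyfun (h i)) -> polyfun (fun r => \prod_(i <- s) h i r).
Proof.
move=> hh; elim: s => [|i s IH].
  by exists 1 => r; rewrite big_nil hornerC.
have [p hp] := polyfunM (hh i) IH; exists p => r; by rewrite big_cons hp.
Qed.

Definition polymx m n (M : F -> 'M[F]_(m, n)) := forall a b, polyfun (fun r => M r a b).

Lemma polymx_cst m n (M : 'M[F]_(m, n)) : polymx (fun=> M).
Proof. by move=> a b; apply: polyfun_cst. Qed.
Lemma polymxD m n (M N : F -> 'M[F]_(m, n)) :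
  polymx M -> polymx N -> polymx (fun r => M r + N r).
Proof.
move=> hM hN a b; have [p hp] := polyfunD (hM a b) (hN a b).
by exists p => r; rewrite mxE hp.
Qed.
Lemma polymxZ m n (M : 'M[F]_(m, n)) : polymx (fun r => r *: M).
Proof.
move=> a b; have [p hp] := polyfunM polyfun_id (polyfun_cst (M a b)).
by exists p => r; rewrite mxE hp.
Qed.
Lemma polymxM m n l (M : F -> 'M[F]_(m, n)) (N : F -> 'M[F]_(n, l)) :
  polymx M -> polymx N -> polymx (fun r => M r *m N r).
Proof.
move=> hM hN a b.
have [p hp] := polyfun_sum (index_enum 'I_n) (fun i => polyfunM (hM a i) (hN i b)).
by exists p => r; rewrite mxE hp.
Qed.
Lemma polymx_sum m n (I : Type) (s : seq I) (h : I -> F -> 'M[F]_(m, n)) :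
  (forall i, polymx (h i)) -> polymx (fun r => \sum_(i <- s) h i r).
Proof.
move=> hh a b; have [p hp] := polyfun_sum s (fun i => hh i a b).
by exists p => r; rewrite summxE hp.
Qed.
Lemma polymxX n (M : F -> 'M[F]_n) e : polymx M -> polymx (fun r => M r ^+ e).
Proof.
move=> hM; elim: e => [|e IH]; first exact: polymx_cst.
move=> a b; have [p hp] := polymxM hM IH a b.
by exists p => r; rewrite exprS -mulmxE hp.
Qed.
Lemma polyfun_det n (M : F -> 'M[F]_n) : polymx M -> polyfun (fun r => \det (M r)).
Proof.
move=> hM; rewrite /determinant; apply: polyfun_sum => s.
apply: polyfunM; first exact: polyfun_cst.
by apply: polyfun_prod => i; apply: hM.
Qed.
Lemma polyfun_mom (mu : F -> nat -> F) P :
  (forall n, polyfun (fun r => mu r n)) -> polyfun (fun r => mom (mu r) P).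
Proof.
move=> h; rewrite /mom; apply: polyfun_sum => i.
by apply: polyfunM => //; apply: polyfun_cst.
Qed.

Lemma poly_fun0 (p : {poly F}) : (forall r, p.[r] = 0) -> p = 0.
Proof.
move=> h; apply/eqP; apply: contraT => p0.
pose rs : seq F := [seq i%:R | i <- iota 0 (size p)].
have /(_ p0) := @max_poly_roots F p rs; rewrite size_map size_iota ltnn; apply.
  by apply/allP => x _; rewrite /root h.
rewrite map_inj_uniq ?iota_uniq // => a b /eqP; rewrite eqr_nat; exact: eqP.
Qed.

(** A polynomial identity that holds at all generic parameters holds at all
    parameters. *)
Lemma polyfun_extend f g : polyfun f -> polyfun g -> f 0 != 0 ->
  (forall r, r != 0 -> f r != 0 -> g r = 0) -> forall r, g r = 0.
Proof.
move=> [p hp] [q hq] f0 h r; rewrite hq.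
suff /eqP : 'X * p * q = 0.
  rewrite !mulf_eq0 polyX_eq0 /= => /orP [] /eqP e; last by rewrite e horner0.
  by move: f0; rewrite hp e horner0 eqxx.
apply: poly_fun0 => s; rewrite !hornerM hornerX -hp -hq.
have [->|s0] := eqVneq s 0; first by rewrite !mul0r.
by have [->|fs] := eqVneq (f s) 0; rewrite ?mulr0 ?mul0r // h ?mulr0.
Qed.

Lemma polyfun_extend0 g : polyfun g -> (forall r, r != 0 -> g r = 0) -> forall r, g r = 0.
Proof.
move=> hg h; apply: (polyfun_extend (polyfun_cst 1) hg); rewrite ?oner_eq0 //.
by move=> r r0 _; apply: h.
Qed.

(** If a form of rank [m] at parameter [0] stays of rank at most [m] along a
    family, then its derivatives vanish on the kernel.  Bordering a nonzero
    minor with [Q1] and [Q2] gives a determinant that vanishes for all [r]; its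
    last row is divisible by [r ^+ e], and at [r = 0] the quotient has a zero
    last column apart from [mom (psi 0) Q2]. *)
Lemma hankel_border (mu psi : F -> nat -> F) m e (Q1 Q2 : {poly F}) :
  (forall n, polyfun (fun r => mu r n)) -> (forall n, polyfun (fun r => psi r n)) ->
  hankel_ge m (mu 0) -> (forall r, ~ hankel_ge (m + 1) (mu r)) ->
  (forall r n, mom (mu r) (Q1 * 'X^n) = r ^+ e * psi r n) ->
  ann (mu 0) Q2 -> mom (psi 0) Q2 = 0.
Proof.
move=> hmu hpsi [p [q dpq]] hmax hQ1 hQ2.
pose M r : 'M[F]_(m + 1) := block_mx (\matrix_(a, b) mom (mu r) (p a * q b))
  (\col_a mom (mu r) (p a * Q2)) (\row_b mom (psi r) (q b)) (mom (psi r) Q2)%:M.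
have hM : polyfun (fun r => \det (M r)).
  apply: polyfun_det => a b; rewrite /M.
  rewrite -[a]splitK -[b]splitK; case: (split a) => a'; case: (split b) => b' /=.
  - have [g hg] := polyfun_mom (p a' * q b') hmu; exists g => r.
    by rewrite block_mxEul mxE.
  - have [g hg] := polyfun_mom (p a' * Q2) hmu; exists g => r.
    by rewrite block_mxEur mxE.
  - have [g hg] := polyfun_mom (q b') hpsi; exists g => r.
    by rewrite block_mxEdl mxE.
  - have [g hg] := polyfun_mom Q2 hpsi; exists g => r.
    by rewrite block_mxEdr mxE !ord1 eqxx mulr1n.
have /(_ 0) : forall r, \det (M r) = 0.
  apply: (polyfun_extend0 hM) => r r0; apply/eqP; apply: contraT => dM; case: (hmax r).
  pose p' (a : 'I_(m + 1)) := match split a with inl a => p a | inr _ => Q1 end.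
  pose q' (a : 'I_(m + 1)) := match split a with inl a => q a | inr _ => Q2 end.
  exists p', q'; pose D : 'M[F]_(m + 1) := block_mx 1%:M 0 0 (r ^+ e)%:M.
  have mulQ1 P : mom (mu r) (Q1 * P) = r ^+ e * mom (psi r) P.
    rewrite -momZl -mom_shift; apply: eq_mom => n; exact: hQ1.
  have -> : \matrix_(a, b) mom (mu r) (p' a * q' b) = D *m M r.
    rewrite /D /M mulmx_block !(mul0mx, mul1mx, addr0, add0r) !mul_scalar_mx.
    apply/matrixP => a b; rewrite mxE -[a in RHS]splitK -[b in RHS]splitK /p' /q'.
    case: (split a) => a'; case: (split b) => b' /=.
    - by rewrite block_mxEul mxE.
    - by rewrite block_mxEur mxE.
    - by rewrite block_mxEdl !mxE mulQ1.
    - by rewrite block_mxEdr !mxE !ord1 eqxx mulQ1 mulr1n.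
  by rewrite det_mulmx mulf_neq0 // det_ublock det1 mul1r det_scalar expf_neq0 // expf_neq0.
have -> : M 0 = block_mx (\matrix_(a, b) mom (mu 0) (p a * q b)) 0
     (\row_b mom (psi 0) (q b)) (mom (psi 0) Q2)%:M.
  rewrite /M; congr block_mx; apply/matrixP => a b; rewrite !mxE.
  by rewrite mulrC ann_mom.
rewrite det_lblock det_scalar1 => /eqP; rewrite mulf_eq0 (negbTE dpq) /=.
exact: eqP.
Qed.

Lemma hankel_first_order (mu delta : F -> nat -> F) m (Q1 Q2 : {poly F}) :
  (forall n, polyfun (fun r => mu r n)) -> (forall n, polyfun (fun r => delta r n)) ->
  hankel_ge m (mu 0) -> (forall r, ~ hankel_ge (m + 1) (mu r)) ->
  (forall r n, mu r n = mu 0 n + r * delta r n) ->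
  ann (mu 0) Q1 -> ann (mu 0) Q2 -> mom (delta 0) (Q1 * Q2) = 0.
Proof.
move=> hmu hde nd hmax e h1 h2; rewrite -mom_shift.
apply: (@hankel_border mu (fun r => shift_mom Q1 (delta r)) m 1 Q1 Q2) => //.
  by move=> n; apply: polyfun_mom.
move=> r n; rewrite (eq_mom _ (e r)) momDl momZl h1 add0r expr1 //.
Qed.

End PolyFun.

(** * Composite moves *)

Section DerivedMoves.
Variables (F : fieldType) (k : nat).
Implicit Types (A B : 'M[F]_k) (i u : 'cV[F]_k) (j v : 'rV[F]_k) (c : F).

Lemma dpow0 A (X : 'M[F]_k) : dpow A X 0 = 0.
Proof. by rewrite /dpow big_ord0. Qed.
Lemma dpow1 A (X : 'M[F]_k) : dpow A X 1 = X.
Proof. by rewrite /dpow big_ord1 /= !expr0 mulmx1 mul1mx. Qed.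

Lemma conn_coshear c A B i1 i2 j1 j2 :
  conn (mkq A B i1 i2 j1 j2) (mkq A B i1 (i2 + c *: i1) (j1 - c *: j2) j2).
Proof.
have := conn_cycle (- c) 0 A B i1 i2 j1 j2.
by rewrite dpow0 scaler0 subr0 expr0 mul1mx mulmx1 !scaleNr opprK.
Qed.

(** With [conn_coshear], the elementary matrices of [GL_2] acting on the pairs
    of columns and rows. *)
Lemma conn_shear c A B i1 i2 j1 j2 :
  conn (mkq A B i1 i2 j1 j2) (mkq A B (i1 + c *: i2) i2 j1 (j2 - c *: j1)).
Proof.
apply: conn_trans (conn_swap _ _ _ _ _ _) _; apply: conn_trans (conn_coshear c _ _ _ _ _ _) _.
exact: conn_swap.
Qed.

Lemma conn_lin c A B i1 i2 j1 j2 :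
  conn (mkq A B i1 i2 j1 j2) (mkq (A + c *: B) B i1 i2 j1 j2).
Proof.
apply: conn_trans (conn_rot _ _ _ _ _ _) _.
apply: conn_trans (conn_addpow (- c) 1 _ _ _ _ _ _) _; rewrite expr1.
do 3 apply: conn_trans (conn_rot _ _ _ _ _ _) _.
rewrite opprK opprD !scaleNr !opprK; exact: conn_refl.
Qed.

(** The potential [a^* x y]: the quarter turn [conn_rot] exchanges the roles of
    [a] and [a^*] before and after [conn_cycle]. *)
Lemma conn_feedback c A B i1 i2 j1 j2 :
  conn (mkq A B i1 i2 j1 j2)
    (mkq (A + c *: (i1 *m j2)) B i1 (i2 - c *: (B *m i1)) (j1 + c *: (j2 *m B)) j2).
Proof.
apply: conn_trans (conn_rot _ _ _ _ _ _) _.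
apply: conn_trans (conn_cycle c 1 _ _ _ _ _ _) _; rewrite dpow1 expr1.
do 3 apply: conn_trans (conn_rot _ _ _ _ _ _) _.
rewrite opprD !opprK; exact: conn_refl.
Qed.

Lemma conn_cofeedback c A B i1 i2 j1 j2 :
  conn (mkq A B i1 i2 j1 j2)
    (mkq (A + c *: (i2 *m j1)) B (i1 - c *: (B *m i2)) i2 j1 (j2 + c *: (j1 *m B))).
Proof.
apply: conn_trans (conn_swap _ _ _ _ _ _) _; apply: conn_trans (conn_feedback c _ _ _ _ _ _) _.
exact: conn_swap.
Qed.

(** When [i2 = 0] the potential [y^* x^* u^n] with [u = a + s a^*] does nothing but
    translate the row [j2]. *)
Lemma conn_row c s n A B i1 j1 j2 :
  conn (mkq A B i1 0 j1 j2) (mkq A B i1 0 j1 (j2 + c *: (j1 *m (A + s *: B) ^+ n))).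
Proof.
apply: conn_trans (conn_lin s _ _ _ _ _ _) _; apply: conn_trans (conn_swap _ _ _ _ _ _) _.
apply: conn_trans (conn_cycle c n _ _ _ _ _ _) _; apply: conn_trans (conn_swap _ _ _ _ _ _) _.
apply: conn_trans (conn_lin (- s) _ _ _ _ _ _) _.
have -> : dpow (A + s *: B) (0 *m j1) n = 0.
  by rewrite /dpow big1 // => l _; rewrite mul0mx mulmx0 mul0mx.
rewrite mulmx0 !scaler0 !subr0 scaleNr addrK; exact: conn_refl.
Qed.

End DerivedMoves.

(** * Matrix elements of powers *)

Section Pairing.
Variables (F : fieldType) (k : nat).
Implicit Types (A B X Y : 'M[F]_k) (i u : 'cV[F]_k) (j v : 'rV[F]_k) (c : F).

Definition matel j X i : F := (j *m X *m i) 0 0.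

Lemma matelDl c j j' X i : matel (j + c *: j') X i = matel j X i + c * matel j' X i.
Proof. by rewrite /matel !mulmxDl -!scalemxAl !mxE. Qed.
Lemma matelDr c j X i i' : matel j X (i + c *: i') = matel j X i + c * matel j X i'.
Proof. by rewrite /matel mulmxDr -!scalemxAr !mxE. Qed.
Lemma matelNr j X i : matel j X (- i) = - matel j X i.
Proof. by rewrite /matel mulmxN mxE. Qed.
Lemma matelDm c j X Y i : matel j (X + c *: Y) i = matel j X i + c * matel j Y i.
Proof. by rewrite /matel mulmxDr mulmxDl -!scalemxAr -scalemxAl !mxE. Qed.
Lemma matel_addm j X Y i : matel j (X + Y) i = matel j X i + matel j Y i.
Proof. by rewrite -[Y]scale1r matelDm mul1r scale1r. Qed.
Lemma matel_subm j X Y i : matel j (X - Y) i = matel j X i - matel j Y i.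
Proof. by rewrite -scaleN1r matelDm mulN1r. Qed.
Lemma matel_sum j I (r : seq I) (f : I -> 'M[F]_k) i :
  matel j (\sum_(l <- r) f l) i = \sum_(l <- r) matel j (f l) i.
Proof. by rewrite /matel mulmx_sumr mulmx_suml summxE. Qed.
Lemma matel_mull j B X i : matel (j *m B) X i = matel j (B *m X) i.
Proof. by rewrite /matel !mulmxA. Qed.
Lemma matel_mulr j B X i : matel j X (B *m i) = matel j (X *m B) i.
Proof. by rewrite /matel !mulmxA. Qed.
Lemma matel_rank1 j X u v Y i : matel j (X *m (u *m v) *m Y) i = matel j X u * matel v Y i.
Proof.
rewrite /matel.
have -> : j *m (X *m (u *m v) *m Y) *m i = (j *m X *m u) *m (v *m Y *m i) by rewrite !mulmxA.
by rewrite {1}[j *m X *m u]mx11_scalar mul_scalar_mx mxE.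
Qed.
Lemma matel_tr j X i : matel j X i = \tr (X *m (i *m j)).
Proof. by rewrite mulmxA mxtrace_mulC mulmxA /matel /mxtrace big_ord1. Qed.

(** The coefficients of the transfer function [j (z - A)^-1 i]. *)
Definition markov j A i : nat -> F := fun n => matel j (A ^+ n) i.

Lemma matel_dpow j A u v n i : matel j (dpow A (u *m v) n) i = conv (markov j A u) (markov v A i) n.
Proof. by rewrite matel_sum; apply: eq_bigr => l _; rewrite matel_rank1. Qed.

End Pairing.

Lemma polyfun_matel (F : numFieldType) k (j : F -> 'rV[F]_k) (X : F -> 'M[F]_k) (i : F -> 'cV[F]_k) :
  polymx j -> polymx X -> polymx i -> polyfun (fun r => matel (j r) (X r) (i r)).
Proof. by move=> hj hX hi; apply: (polymxM (polymxM hj hX) hi). Qed.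

Lemma polymx_affine (F : numFieldType) m n (M N : 'M[F]_(m, n)) : polymx (fun r => M + r *: N).
Proof. by apply: polymxD; [apply: polymx_cst | apply: polymxZ]. Qed.

(** * Points of maximal Hankel rank *)

Section Maximal.
Variables (F : numFieldType) (k : nat) (tau : F).
Local Notation quad := (quad F k).
Variables (q0 : quad) (m : nat).
Hypothesis q0_moment : moment q0 = tau%:M.
Hypothesis q0_max : forall A B i1 i2 j1 j2, conn q0 (mkq A B i1 i2 j1 j2) ->
  ~ hankel_ge (m + 1) (markov j2 A i1).

(** In this section [m] is the largest rank of the Hankel form of
    [markov j2 A i1] on the class of [q0], and each move that stays in the class
    gives, by [hankel_border], an identity between functionals on a power of
    the kernel. *)
Section AtPoint.
Variables (A B : 'M[F]_k) (i1 i2 : 'cV[F]_k) (j1 j2 : 'rV[F]_k) (C : {poly F}).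
Hypothesis q0q : conn q0 (mkq A B i1 i2 j1 j2).
Hypothesis nd : hankel_ge m (markov j2 A i1).
Hypothesis hC : ann (markov j2 A i1) C.

Lemma comm_AB : A *m B - B *m A = tau%:M + (i1 *m j1 + i2 *m j2).
Proof.
have := conn_moment q0q q0_moment; rewrite moment_mkq => /eqP.
by rewrite subr_eq => /eqP.
Qed.

(** The trace of [A ^+ n] times the moment equation. *)
Lemma trace_id n : markov j1 A i1 n + markov j2 A i2 n = - tau * \tr (A ^+ n).
Proof.
rewrite /markov !matel_tr -mxtraceD -mulmxDr.
have <- : A *m B - B *m A - tau%:M = i1 *m j1 + i2 *m j2 by rewrite comm_AB addrC addKr.
rewrite !mulmxBr !linearB /= mul_mx_scalar mxtraceZ.
suff -> : \tr (A ^+ n *m (A *m B)) = \tr (A ^+ n *m (B *m A)) by rewrite subrr sub0r mulNr.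
rewrite (mulmxA _ B A) (mxtrace_mulC _ A) !mulmxA.
by congr (\tr (_ *m _)); rewrite mulmxE -exprSr exprS.
Qed.

Definition shear_markov s := markov (j2 - s *: j1) A (i1 + s *: i2).

Lemma shear_markovE s n : shear_markov s n = markov j2 A i1 n +
  s * ((markov j2 A i2 n - markov j1 A i1 n) - s * markov j1 A i2 n).
Proof. rewrite /shear_markov /markov -scaleNr matelDl !matelDr; ring. Qed.

Lemma polyfun_shear n : polyfun (fun s => shear_markov s n).
Proof.
apply: polyfun_matel; [|exact: polymx_cst|exact: polymx_affine].
have h := polymx_affine j2 (- j1).
by move=> a b; have [p hp] := h a b; exists p => r; rewrite -hp scalerN.
Qed.

Lemma shear_max s : ~ hankel_ge (m + 1) (shear_markov s).
Proof. exact: (q0_max (conn_trans q0q (conn_shear s _ _ _ _ _ _))). Qed.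

Lemma shear0 : shear_markov 0 = markov j2 A i1.
Proof. by rewrite /shear_markov !scale0r subr0 addr0. Qed.

(** First order of the shear [conn_shear]. *)
Lemma diag_ann : ann (fun n => markov j2 A i2 n - markov j1 A i1 n) (C * C).
Proof.
move=> n; rewrite -mulrA.
pose delta s n := (markov j2 A i2 n - markov j1 A i1 n) - s * markov j1 A i2 n.
have -> : mom (fun n => markov j2 A i2 n - markov j1 A i1 n) (C * (C * 'X^n)) = mom (delta 0) (C * (C * 'X^n)).
  by apply: eq_mom => l; rewrite /delta mul0r subr0.
apply: (@hankel_first_order F shear_markov delta m); rewrite ?shear0 //.
- exact: polyfun_shear.
- move=> l; exists ((markov j2 A i2 l - markov j1 A i1 l)%:P - (markov j1 A i2 l) *: 'X) => r.
  by rewrite /delta !hornerE mulrC.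
- exact: shear_max.
- by move=> r l; rewrite shear_markovE.
- exact: ann_mulr.
Qed.

(** Second order of the shear, once the first order vanishes. *)
Lemma off_ann : ann (markov j1 A i2) (C ^+ 3).
Proof.
move=> n.
have e : mom (shift_mom (C * C) (fun n => (-1) * markov j1 A i2 n)) (C * 'X^n) = 0.
  apply: (@hankel_border F shear_markov (fun=> shift_mom (C * C) (fun n => (-1) * markov j1 A i2 n)) m 2 (C * C)).
  - exact: polyfun_shear.
  - by move=> l; apply: polyfun_cst.
  - by rewrite shear0.
  - exact: shear_max.
  - move=> r l; rewrite (eq_mom _ (shear_markovE r)) momDl momZl.
    rewrite (_ : mom (markov j2 A i1) _ = 0); last by rewrite -mulrA ann_mom.
    rewrite add0r (eq_mom (nu := fun n => (markov j2 A i2 n - markov j1 A i1 n) + r * ((-1) * markov j1 A i2 n))).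
      by rewrite momDl diag_ann add0r momZl /shift_mom mulrA.
    by move=> ?; ring.
  - by rewrite shear0; apply: ann_mulr.
move: e; rewrite mom_shift momZl mulN1r => /eqP; rewrite oppr_eq0 => /eqP e.
by rewrite -[RHS]e; congr mom; ring.
Qed.

(** First order of [conn_cofeedback], performed after [conn_coshear] with
    parameter [c].  The three terms are the variations of the row, of [A] and of the
    column. *)
Lemma feedback_id c S : let u := i2 + c *: i1 in let v := j1 - c *: j2 in
  mom (fun n => matel v (B *m A ^+ n) i1 + (conv (markov j2 A u) (markov v A i1) n
      - matel j2 (A ^+ n *m B) u)) (C * (C * S)) = 0.
Proof.
move=> u v.
pose Ar r := A + r *: (u *m v); pose jr r := j2 + r *: (v *m B).
pose ir r := i1 + r *: (- (B *m u)).
pose mu r := markov (jr r) (Ar r) (ir r).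
pose delta r n := matel (v *m B) (Ar r ^+ n) (ir r)
  + (matel j2 (\sum_(l < n) Ar r ^+ l *m (u *m v) *m A ^+ (n - l.+1)) (ir r)
     - matel j2 (A ^+ n) (B *m u)).
have A0 : Ar 0 = A by rewrite /Ar scale0r addr0.
have j0 : jr 0 = j2 by rewrite /jr scale0r addr0.
have i0 : ir 0 = i1 by rewrite /ir scale0r addr0.
have mu0 : mu 0 = markov j2 A i1 by rewrite /mu A0 j0 i0.
have -> : mom (fun n => matel v (B *m A ^+ n) i1 + (conv (markov j2 A u) (markov v A i1) n
      - matel j2 (A ^+ n *m B) u)) (C * (C * S)) = mom (delta 0) (C * (C * S)).
  apply: eq_mom => n; rewrite /delta A0 i0 matel_mull matel_mulr.
  by rewrite -[\sum_(l < n) _]/(dpow A (u *m v) n) matel_dpow.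
have polyA : polymx Ar by apply: polymx_affine.
have polyi : polymx ir by apply: polymx_affine.
apply: (@hankel_first_order F mu delta m); rewrite ?mu0 //.
- by move=> n; apply: polyfun_matel => //; [apply: polymx_affine | apply: polymxX].
- move=> n; apply: polyfunD.
    by apply: polyfun_matel => //; [apply: polymx_cst | apply: polymxX].
  apply: polyfunD; last exact: polyfun_cst.
  apply: polyfun_matel => //; first exact: polymx_cst.
  apply: polymx_sum => l; apply: polymxM; last exact: polymx_cst.
  by apply: polymxM; [apply: polymxX | apply: polymx_cst].
- move=> r; rewrite /mu /Ar /jr /ir scalerN.
  apply: (q0_max (conn_trans q0q (conn_trans (conn_coshear c _ _ _ _ _ _) (conn_cofeedback r _ _ _ _ _ _)))).
- move=> r n; rewrite /delta.
  have -> : mu r n = matel j2 (Ar r ^+ n) (ir r) + r * matel (v *m B) (Ar r ^+ n) (ir r).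
    by rewrite /mu /markov {1}/jr matelDl.
  have -> : matel j2 (Ar r ^+ n) (ir r) = matel j2 (A ^+ n) (ir r)
     + r * matel j2 (\sum_(l < n) Ar r ^+ l *m (u *m v) *m A ^+ (n - l.+1)) (ir r).
    rewrite -matelDm; congr matel.
    have := telescope_comm (Ar r) 1 A n; rewrite !mulr1 !mul1r => /eqP.
    rewrite eq_sym subr_eq => /eqP ->; rewrite addrC; congr (_ + _).
    rewrite scaler_sumr; apply: eq_bigr => l _.
    have -> : Ar r - A = r *: (u *m v) by rewrite /Ar addrC addKr.
    by rewrite -!mulmxE -scalemxAr -scalemxAl.
  rewrite [matel j2 (A ^+ n) (ir r)]matelDr matelNr /markov; ring.
- exact: ann_mulr.
Qed.

(** The part of [feedback_id] that is linear in [c].  Its terms with [conv]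
    cancel by [diag_ann], since the divided difference is symmetric. *)
Lemma anti_id S : mom (fun n => matel j2 (A ^+ n *m B + B *m A ^+ n) i1) (C ^+ 3 * S) = 0.
Proof.
pose x1 n := matel j1 (B *m A ^+ n) i1 - matel j2 (A ^+ n *m B) i2.
pose x2 n := matel j2 (A ^+ n *m B + B *m A ^+ n) i1.
pose a := markov j1 A i1; pose b := markov j2 A i2; pose L := markov j2 A i1.
pose P := C ^+ 3 * S.
have key c : mom x1 P + mom (conv b a) P - c * mom x2 P
    - c ^+ 2 * mom (conv L L) P + c * (mom (conv L a) P - mom (conv b L) P) = 0.
  rewrite -[RHS](feedback_id c (C * S)) (_ : C * (C * (C * S)) = P); last by rewrite /P; ring.
  rewrite [RHS](eq_mom (nu := fun n => (x1 n + (- c) * x2 n)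
      + conv (fun n => c * L n + b n) (fun n => (- c) * L n + a n) n)).
    rewrite (momDl (fun n => x1 n + (- c) * x2 n)) (momDl x1) (momZl (- c) x2).
    rewrite conv_linl !conv_linr; ring.
  move=> n; rewrite (eq_conv (mu' := fun n => c * L n + b n) (nu' := fun n => (- c) * L n + a n)).
  - rewrite -[j1 - c *: j2]/(j1 - c *: j2) -scaleNr matelDl matelDr /x1 /x2 matel_addm; ring.
  - by move=> l; rewrite /markov matelDr addrC.
  - by move=> l; rewrite /markov -scaleNr matelDl addrC.
have eLa : mom (conv L a) P - mom (conv b L) P = 0.
  have : mom (conv L (fun n => (-1) * b n + a n)) P = 0.
    rewrite (_ : P = C * (C * C * S)); last by rewrite /P; ring.
    apply: mom_conv_ann => //; apply: ann_mulr => n.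
    rewrite (eq_mom (nu := fun l => (-1) * (b l - a l))); first by rewrite momZl diag_ann mulr0.
    by move=> l; ring.
  rewrite conv_linr (eq_mom _ (conv_sym L b)) mulN1r addrC => <-; ring.
(* The values at [c = 1] and [c = -1] isolate the linear coefficient. *)
move: (key 1) (key (-1)); rewrite eLa !mulr0 !addr0 => k1 k2.
have /eqP : (2%:R : F) * mom x2 P = 0.
  rewrite -[RHS]subr0 -{1}k2 -{1}k1; ring.
by rewrite mulf_eq0 pnatr_eq0 => /eqP.
Qed.
End AtPoint.

Section Conclusion.
Variables (A B : 'M[F]_k) (i1 i2 : 'cV[F]_k) (j1 j2 : 'rV[F]_k) (C : {poly F}).
Hypothesis q0q : conn q0 (mkq A B i1 i2 j1 j2).
Hypothesis nd : hankel_ge m (markov j2 A i1).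
Hypothesis hC : ann (markov j2 A i1) C.

Lemma shear_ann s : ann (shear_markov A i1 i2 j1 j2 s) (C ^+ 3).
Proof.
move=> n; pose Q := C ^+ 3 * 'X^n; rewrite -/Q.
have -> : mom (shear_markov A i1 i2 j1 j2 s) Q = mom (markov j2 A i1) Q +
    (s * mom (fun n => markov j2 A i2 n - markov j1 A i1 n) Q + (- s ^+ 2) * mom (markov j1 A i2) Q).
  rewrite -!momZl -!momDl; apply: eq_mom => l; rewrite shear_markovE; ring.
have e3 : C ^+ 3 = C * C * C by ring.
have -> : mom (markov j1 A i2) Q = 0 := off_ann q0q nd hC n.
have -> : mom (fun n => markov j2 A i2 n - markov j1 A i1 n) Q = 0.
  by rewrite /Q e3; apply: (ann_mulr C (diag_ann q0q nd hC)).
by rewrite /Q e3 !mulr0 !addr0 -!mulrA ann_mom.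
Qed.

(** [anti_id] holds at almost all points of the curve [conn_shear], because the
    rank is still maximal there and [C ^+ 3] still lies in the kernel, whence the
    exponent [9 = 3 * 3].  This is the linear coefficient in the parameter of the
    curve. *)
Lemma scalar_id S :
  mom (fun n => matel j2 (A ^+ n *m B + B *m A ^+ n) i2) (C ^+ 9 * S) =
  mom (fun n => matel j1 (A ^+ n *m B + B *m A ^+ n) i1) (C ^+ 9 * S).
Proof.
pose y j i n := matel j (A ^+ n *m B + B *m A ^+ n) i.
pose g s := mom (y (j2 - s *: j1) (i1 + s *: i2)) (C ^+ 9 * S).
have gE s : g s = mom (y j2 i1) (C ^+ 9 * S) +
  (s * (mom (y j2 i2) (C ^+ 9 * S) - mom (y j1 i1) (C ^+ 9 * S))
   - s ^+ 2 * mom (y j1 i2) (C ^+ 9 * S)).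
  rewrite /g (eq_mom (nu := fun n => y j2 i1 n + (s * y j2 i2 n +
    ((- s) * y j1 i1 n + (- s ^+ 2) * y j1 i2 n)))).
    rewrite (momDl (y j2 i1)) (momDl (fun n => s * y j2 i2 n)) (momDl (fun n => - s * y j1 i1 n)).
    rewrite !momZl; ring.
  by move=> n; rewrite /y -scaleNr matelDl !matelDr; ring.
have g0 : forall s, g s = 0.
  have [p [q dpq]] := nd.
  pose f s := \det (\matrix_(a < m, b < m) mom (shear_markov A i1 i2 j1 j2 s) (p a * q b)).
  apply: (@polyfun_extend F f).
  - apply: polyfun_det => a b.
    have [h hh] := polyfun_mom (p a * q b) (polyfun_shear A i1 i2 j1 j2).
    by exists h => r; rewrite mxE.
  - exists ((mom (y j2 i1) (C ^+ 9 * S))%:P +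
     ((mom (y j2 i2) (C ^+ 9 * S) - mom (y j1 i1) (C ^+ 9 * S)) *: 'X
      - (mom (y j1 i2) (C ^+ 9 * S)) *: 'X^2)) => r.
    by rewrite gE !hornerD hornerN !hornerZ hornerC hornerX hornerXn; ring.
  - by rewrite /f shear0.
  - move=> s _ fs; rewrite /g.
    have -> : C ^+ 9 * S = (C ^+ 3) ^+ 3 * S by rewrite -exprM.
    apply: (anti_id (conn_trans q0q (conn_shear s _ _ _ _ _ _))).
      by exists p, q.
    exact: shear_ann.
have := g0 1; have := g0 (-1); rewrite !gE => e1 e2.
have /eqP : (2%:R : F) * (mom (y j2 i2) (C ^+ 9 * S) - mom (y j1 i1) (C ^+ 9 * S)) = 0.
  rewrite -[RHS]subr0 -{1}e2 -{1}e1; ring.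
by rewrite mulf_eq0 pnatr_eq0 /= subr_eq0 => /eqP.
Qed.

Lemma comm_id j i n : matel j (A ^+ n *m B) i - matel j (B *m A ^+ n) i =
  tau * (n%:R * markov j A i n.-1) + (conv (markov j A i1) (markov j1 A i) n + conv (markov j A i2) (markov j2 A i) n).
Proof.
rewrite -matel_subm !mulmxE -telescope_comm.
have -> : \sum_(l < n) A ^+ l * (A * B - B * A) * A ^+ (n - l.+1) =
    (dpow A (i1 *m j1) n + dpow A (i2 *m j2) n) + (tau * n%:R) *: A ^+ n.-1.
  rewrite -!big_split /= mulrC -scalerA scaler_nat -[X in _ *+ X](card_ord n) -sumr_const.
  rewrite -big_split /=; apply: eq_bigr => l _.
  rewrite -!mulmxE (comm_AB q0q) mulmxDr mulmxDl addrC mulmxDr mulmxDl.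
  congr (_ + _); rewrite mul_mx_scalar -scalemxAl mulmxE -exprD.
  by have -> : (l + (n - l.+1))%N = n.-1 by rewrite -[in RHS](subnKC (ltn_ord l)).
apply: (etrans (matelDm (tau * n%:R) j _ (A ^+ n.-1) i)).
by rewrite matel_addm !matel_dpow addrC mulrA.
Qed.

(** The key identity.  Here [feedback_id] at [c = 0] is E1 and [scalar_id] is
    E4; together they evaluate [j1 [A^n, B] i1 + j2 [A^n, B] i2] as twice
    [conv b a], whereas [comm_id] evaluates it as [- tau^2] times the trace of the
    derivative plus quadratic terms.  The quadratic terms add up to
    [conv (b - a) (b - a) + 2 conv L L'], which vanishes on high powers of [C]. *)
Lemma trace_deriv0 S : tau != 0 -> mom (fun n => n%:R * \tr (A ^+ n.-1)) (C ^+ 9 * S) = 0.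
Proof.
move=> tau0.
pose P := C ^+ 9 * S.
pose a := markov j1 A i1; pose b := markov j2 A i2; pose L := markov j2 A i1; pose L' := markov j1 A i2.
pose p1 n := matel j1 (A ^+ n *m B) i1; pose b1 n := matel j1 (B *m A ^+ n) i1.
pose p2 n := matel j2 (A ^+ n *m B) i2; pose b2 n := matel j2 (B *m A ^+ n) i2.
have E1 : mom b1 P - mom p2 P + mom (conv b a) P = 0.
  have := feedback_id q0q nd hC 0 (C ^+ 7 * S).
  rewrite (_ : C * (C * (C ^+ 7 * S)) = P); last by rewrite /P; ring.
  rewrite !scale0r !subr0 !addr0 => <-.
  rewrite [RHS](eq_mom (nu := fun n => (b1 n + (-1) * p2 n) + conv b a n)).
    rewrite (momDl (fun n => b1 n + (-1) * p2 n)) (momDl b1) (momZl _ p2); ring.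
  by move=> n; rewrite /b1 /p2; ring.
have E4 : mom p2 P + mom b2 P = mom p1 P + mom b1 P.
  have := scalar_id S; rewrite -/P.
  rewrite (eq_mom (nu := fun n => p2 n + b2 n)) ?momDl; last by move=> n; rewrite matel_addm.
  by move=> ->; rewrite -momDl; apply: eq_mom => n; rewrite matel_addm.
have E5 : mom p1 P - mom b1 P + (mom p2 P - mom b2 P) =
   - tau ^+ 2 * mom (fun n => n%:R * \tr (A ^+ n.-1)) P +
   (mom (conv a a) P + mom (conv b b) P + (mom (conv L L') P + mom (conv L L') P)).
  transitivity (mom (fun n => (p1 n + (-1) * b1 n) + (p2 n + (-1) * b2 n)) P).
    rewrite (momDl (fun n => p1 n + (-1) * b1 n)) (momDl p1) (momDl p2) !momZl; ring.
  rewrite (eq_mom (nu := fun n => (- tau ^+ 2) * (n%:R * \tr (A ^+ n.-1)) +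
    ((conv a a n + conv b b n) + (conv L L' n + conv L L' n)))).
    rewrite (momDl (fun n => (- tau ^+ 2) * (n%:R * \tr (A ^+ n.-1)))) momZl.
    by rewrite (momDl (fun n => conv a a n + conv b b n)) !(momDl (conv _ _)).
  move=> n; rewrite !mulN1r /p1 /b1 /p2 /b2 !comm_id.
  rewrite -/a -/b -/L -/L' (conv_sym L' L).
  transitivity (tau * (n%:R * (a n.-1 + b n.-1)) +
    (conv a a n + conv b b n + (conv L L' n + conv L L' n))); first by ring.
  rewrite (trace_id q0q); ring.
have E6 : mom (conv a a) P + mom (conv b b) P = 2%:R * mom (conv b a) P.
  have : mom (conv (fun n => (-1) * a n + b n) (fun n => (-1) * a n + b n)) P = 0.
    have an : ann (fun n => (-1) * a n + b n) (C * C).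
      move=> n; rewrite -[RHS](diag_ann q0q nd hC n); apply: eq_mom => l.
      by rewrite mulN1r addrC.
    rewrite (_ : P = (C * C) * (C * C * (C ^+ 5 * S))); last by rewrite /P; ring.
    by apply: mom_conv_ann => //; apply: ann_mulr.
  rewrite conv_linl !conv_linr (eq_mom _ (conv_sym a b)) => e.
  by apply/eqP; rewrite -subr_eq0 -[X in _ == X]e; apply/eqP; ring.
have E7 : mom (conv L L') P = 0.
  rewrite (_ : P = C * (C ^+ 3 * (C ^+ 5 * S))); last by rewrite /P; ring.
  apply: mom_conv_ann => //; apply: ann_mulr; exact: (off_ann q0q nd hC).
have /eqP : tau ^+ 2 * mom (fun n => n%:R * \tr (A ^+ n.-1)) P = 0.
  have -> : tau ^+ 2 * mom (fun n => n%:R * \tr (A ^+ n.-1)) P = mom (conv a a) P + mom (conv b b) P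
    + (mom (conv L L') P + mom (conv L L') P) - (mom p1 P - mom b1 P + (mom p2 P - mom b2 P)).
    rewrite E5; ring.
  have -> : mom p1 P = mom p2 P + mom b2 P - mom b1 P by rewrite E4; ring.
  rewrite E6 E7; transitivity (2%:R * (mom b1 P - mom p2 P + mom (conv b a) P)); first by ring.
  by rewrite E1 mulr0.
by rewrite mulf_eq0 expf_eq0 /= (negbTE tau0) => /eqP.
Qed.

End Conclusion.
End Maximal.

(** * Cyclic columns *)

Lemma trace_idem (F : fieldType) k (e : 'M[F]_k) : e *m e = e -> \tr e = (\rank e)%:R.
Proof.
move=> ee; rewrite -{1}[e]mulmx_base mxtrace_mulC.
suff -> : row_base e *m col_base e = 1%:M by rewrite mxtrace1.
have ff : row_full (col_base e) := col_base_full e.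
apply: (row_free_inj (row_base_free e)); rewrite mul1mx; apply: (row_full_inj ff).
by rewrite -(mulmxA (row_base e)) (mulmxA (col_base e)) !mulmx_base.
Qed.

Section Eigen.
Variables (F : numFieldType) (n : nat).
Implicit Types (A : 'M[F]_n.+1) (phi : 'rV[F]_n.+1) (i : 'cV[F]_n.+1) (j : 'rV[F]_n.+1).

Lemma horner_eigen A phi lam P :
  phi *m A = lam *: phi -> phi *m horner_mx A P = P.[lam] *: phi.
Proof.
move=> e; elim/poly_ind: P => [|p c IH]; first by rewrite rmorph0 mulmx0 horner0 scale0r.
rewrite rmorphD rmorphM /= horner_mx_X horner_mx_C mulmxDr -mulmxE mulmxA IH.
by rewrite -scalemxAl e hornerMXaddC scalerDl scalerA mul_mx_scalar.
Qed.

Lemma mom_trace_deriv A P :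
  mom (fun d => d%:R * \tr (A ^+ d.-1)) P = \tr (horner_mx A P^`()).
Proof.
apply/esym; apply: (@mom_ext F (fun P => \tr (horner_mx A P^`()))) => [c p q|d].
  by rewrite derivD derivZ linearP /= linearP.
by rewrite derivXn rmorphMn /= rmorphXn /= horner_mx_X raddfMn /= mulr_natl.
Qed.

(** Otherwise there is, by the Chinese remainder theorem, a multiple [P] of
    [C ^+ e] that agrees with ['X - lam] to high order at [lam] and vanishes to
    second order at the other eigenvalues.  Then [P'] of [A] is the spectral
    projector at [lam], and its trace is a positive integer. *)
Lemma root_of_trace_deriv A phi lam C e : phi != 0 -> phi *m A = lam *: phi ->
  (forall S, mom (fun d => d%:R * \tr (A ^+ d.-1)) (C ^+ e * S) = 0) -> root C lam.
Proof.
move=> phi0 ephi h; apply: contraT => Clam.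
have D0 : char_poly A != 0 by rewrite monic_neq0 ?char_poly_monic.
have [d [E]] := multiplicity_XsubC (char_poly A) lam; rewrite D0 /= => Elam eD.
set x := 'X - lam%:P in eD.
have : coprimep (x ^+ d.+1) (C ^+ e * E ^+ 2).
  by rewrite coprimep_expl // coprimepMr !coprimep_expr // coprimep_sym coprimep_XsubC.
move=> /Bezout_eq1_coprimepP [[u v] /= uv].
(* [x v C^e E^2 = x (1 - u x^(d+1))] is [x] to high order at [lam]. *)
pose P := C ^+ e * (E ^+ 2 * (x * v)).
have dx : x^`() = 1 by rewrite derivB derivX derivC subr0.
have eP : P = x * (1 - u * x ^+ d.+1) by rewrite -uv /P; ring.
have eP1 : P^`() = 1 - x ^+ d * (x * (u + u^`() * x + u *+ d.+1)).
  rewrite eP derivM dx derivB derivC derivM deriv_exp dx !exprS -mulr_natr; ring.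
have eP2 : P^`() = E * ((C ^+ e * (E * (x * v)))^`() + E^`() * (C ^+ e * (x * v))).
  rewrite (_ : P = E * (C ^+ e * (E * (x * v)))); last by rewrite /P; ring.
  rewrite [LHS]derivM; ring.
pose p := horner_mx A P^`().
have pp : p *m p = p.
  apply/eqP; rewrite -subr_eq0 mulmxE -[X in _ - X]mulr1 -mulrBr.
  have -> : p - 1 = horner_mx A (P^`() - 1) by rewrite rmorphB rmorph1.
  rewrite -rmorphM /= {1}eP2 {1}eP1.
  rewrite (_ : _ * _ = char_poly A * (- ((C ^+ e * (E * (x * v)))^`() + E^`() * (C ^+ e * (x * v)))
     * (x * (u + u^`() * x + u *+ d.+1)))); last by rewrite eD; ring.
  by rewrite rmorphM /= Cayley_Hamilton mul0r.
have := h (E ^+ 2 * (x * v)); rewrite -/P mom_trace_deriv -/p trace_idem //.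
move/eqP; rewrite pnatr_eq0 mxrank_eq0 => /eqP p0.
have := horner_eigen P^`() ephi; rewrite -/p p0 mulmx0 eP1 => /esym/eqP.
rewrite hornerD hornerN !hornerM hornerC hornerXsubC subrr mul0r mulr0 subr0.
by rewrite scale1r (negbTE phi0).
Qed.

End Eigen.

Section Cyclic.
Variables (F : numClosedFieldType) (n : nat).
Local Notation k := n.+1.
Implicit Types (A B : 'M[F]_k) (phi j : 'rV[F]_k) (i : 'cV[F]_k).

Definition cyclic A i := forall phi, (forall d, phi *m A ^+ d *m i = 0) -> phi = 0.

Lemma mom_horner A j i P : mom (markov j A i) P = matel j (horner_mx A P) i.
Proof.
apply/esym; apply: (@mom_ext F (fun P => matel j (horner_mx A P) i)) => [c p q|d].
  rewrite linearP /= [c *: _ + _]addrC; apply: (etrans (matelDm c j _ (horner_mx A p) i)).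
  by rewrite addrC.
by rewrite rmorphXn /= horner_mx_X.
Qed.

(** [Q] is a least annihilator of [phi] divided by a linear factor. *)
Lemma eigen_in A phi : phi != 0 -> exists Q lam, phi *m horner_mx A Q != 0 /\
  phi *m horner_mx A Q *m A = lam *: (phi *m horner_mx A Q).
Proof.
move=> phi0.
have ex : exists d, `[< exists Q : {poly F}, [/\ size Q = d, Q != 0 & phi *m horner_mx A Q = 0] >].
  exists (size (char_poly A)); apply/asboolP; exists (char_poly A).
  by rewrite monic_neq0 ?char_poly_monic // Cayley_Hamilton mulmx0.
have [d /asboolP [Q [sQ Q0 kQ]] dmin] := ex_minnP ex.
have [lam rQ] : exists lam, root Q lam.
  apply/closed_rootP/negP => /size_poly1P [c c0 eQ]; move: kQ.
  by rewrite eQ horner_mx_C mul_mx_scalar => /eqP; rewrite scaler_eq0 (negbTE c0) (negbTE phi0).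
have [R eQ] := factor_theorem _ _ rQ.
exists R, lam; split.
  apply: contraTneq (leqnn d) => kR; rewrite -ltnNge.
  have R0 : R != 0 by apply: contraNneq Q0 => R0; rewrite eQ R0 mul0r.
  apply: leq_ltn_trans (dmin (size R) _) _.
    by apply/asboolP; exists R.
  by rewrite -sQ eQ size_Mmonic ?monicXsubC // size_XsubC addn2.
move: kQ; rewrite eQ rmorphM rmorphB /= horner_mx_X horner_mx_C -mulmxE mulmxA mulmxBr.
by rewrite mul_mx_scalar => /eqP; rewrite subr_eq0 => /eqP.
Qed.

Lemma min_ann A j i : exists C : {poly F}, [/\ C != 0, ann (markov j A i) C &
  forall R : {poly F}, R != 0 -> (size R < size C)%N -> ~ ann (markov j A i) R].
Proof.
have ex : exists d, `[< exists Q : {poly F}, [/\ size Q = d, Q != 0 & ann (markov j A i) Q] >].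
  exists (size (char_poly A)); apply/asboolP; exists (char_poly A); split=> //.
    by rewrite monic_neq0 ?char_poly_monic.
  by move=> d; rewrite mom_horner rmorphM /= Cayley_Hamilton mul0r /matel mulmx0 mul0mx mxE.
have [d /asboolP [C [sC C0 hC]] dmin] := ex_minnP ex.
exists C; split=> // R R0; rewrite sC ltnNge => /negP lt hR; apply: lt.
by apply: dmin; apply/asboolP; exists R.
Qed.

(** If [mom mu R] vanished, so would [mom mu (R * 'X^d)], as it is multiplied
    by [lam] when [d] increases. *)
Lemma root_ann (mu : nat -> F) R lam :
  ann mu (R * ('X - lam%:P)) -> ~ ann mu R -> mom mu R != 0.
Proof.
move=> h; apply: contra_not_neq => R0 d.
elim: d => [|d IH]; first by rewrite expr0 mulr1.
have := h d; rewrite (_ : R * ('X - lam%:P) * 'X^d = R * 'X^(d.+1) - lam *: (R * 'X^d)).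
  by rewrite linearB linearZ /= IH mulr0 subr0.
by rewrite exprS -mul_polyC; ring.
Qed.

(** On any vector [A + c i j] differs from [A] by a multiple of [i], so the
    feedback does not change the space generated by [i]; dually for rows in
    [feedback_left]. *)
Lemma feedback_right c A i j P : exists S, horner_mx (A + c *: (i *m j)) P *m i = horner_mx A S *m i.
Proof.
elim/poly_ind: P => [|p a [S IH]]; first by exists 0; rewrite !rmorph0.
exists ('X * S + (c * (j *m (horner_mx A S *m i)) 0 0)%:P + a%:P).
rewrite mulrC !rmorphD !rmorphM /= !horner_mx_X !horner_mx_C !mulmxDl -!mulmxE.
rewrite -!mulmxA IH !mulmxDl; congr (_ + _ + _).
rewrite -scalemxAl !mul_scalar_mx; congr (_ *: _).
by rewrite -mulmxA {1}[j *m _]mx11_scalar mul_mx_scalar.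
Qed.

Lemma feedback_left c A i j P : exists S, j *m horner_mx (A + c *: (i *m j)) P = j *m horner_mx A S.
Proof.
elim/poly_ind: P => [|p a [S IH]]; first by exists 0; rewrite !rmorph0.
exists (S * 'X + (c * (j *m horner_mx A S *m i) 0 0)%:P + a%:P).
rewrite !rmorphD !rmorphM /= !horner_mx_X !horner_mx_C !mulmxDr -!mulmxE.
rewrite !mulmxA IH !mulmxDr; congr (_ + _ + _).
rewrite -scalemxAr mulmxA {1}[j *m _ *m i]mx11_scalar mul_scalar_mx.
by rewrite !mul_mx_scalar scalerA mulrC -scalerA.
Qed.

Lemma hankel_ge_le m A j i : hankel_ge m (markov j A i) -> (m <= k)%N.
Proof.
move=> [p [q]]; set M := \matrix_(a, b) _ => dM.
have uM : M \in unitmx by rewrite unitmxE unitfE.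
have <- : \rank M = m by apply: mxrank_unit.
have -> : M = (\matrix_(a < m) (j *m horner_mx A (p a))) *m
    (\matrix_(b < m) (horner_mx A (q b) *m i)^T)^T.
  apply/matrixP => a b; rewrite !mxE mom_horner rmorphM /= /matel -mulmxE !mulmxA -mulmxA mxE.
  by apply: eq_bigr => l _; rewrite !mxE.
exact: leq_trans (mulmx_max_rank _ _) _.
Qed.

Lemma hankel_ge_feedback m c A j i : hankel_ge m (markov j A i) -> hankel_ge m (markov j (A + c *: (i *m j)) i).
Proof.
move=> [p [q dpq]]; set A1 := A + _.
have eA : A = A1 + (- c) *: (i *m j) by rewrite scaleNr addrK.
have /fin_all_exists [p' hp] a : exists S, j *m horner_mx A (p a) = j *m horner_mx A1 S.
  by rewrite eA; apply: feedback_left.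
have /fin_all_exists [q' hq] a : exists S, horner_mx A (q a) *m i = horner_mx A1 S *m i.
  by rewrite eA; apply: feedback_right.
exists p', q'; rewrite (_ : \matrix_(_, _) _ = \matrix_(a, b) mom (markov j A i) (p a * q b)) //.
apply/matrixP => a b; rewrite !mxE !mom_horner !rmorphM /= /matel -!mulmxE.
by rewrite !mulmxA -[LHS]/((_ *m _ *m _) _ _) -mulmxA -hp -hq mulmxA.
Qed.

(** Take a point of maximal Hankel rank.  If [i1] were not cyclic for [A], the
    orthogonal of the space that it generates would contain a left eigenvector
    [phi], with the same eigenvalue [lam] for [A] and for [A1 = A + i1 j2].  Both
    points have maximal rank, so [lam] is a root of an annihilator of least
    degree for each of them; write these as [R * ('X - lam)] and
    [R1 * ('X - lam)].  Then [j2 R(A) (A1 - lam) R1(A1) i1] is zero, yet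
    expanding [A1 = A + i1 j2] it is the product of two nonzero numbers. *)
Lemma reach_cyclic tau (q0 : quad F k) : tau != 0 -> moment q0 = tau%:M ->
  exists A B i1 i2 j1 j2, conn q0 (mkq A B i1 i2 j1 j2) /\ cyclic A i1.
Proof.
move=> tau0 mom0.
pose P m := `[< exists A B i1 i2 j1 j2, conn q0 (mkq A B i1 i2 j1 j2) /\ hankel_ge m (markov j2 A i1) >].
have P0 : exists m, P m.
  exists 0%N; apply/asboolP.
  exists (qA q0), (qB q0), (qi1 q0), (qi2 q0), (qj1 q0), (qj2 q0).
  rewrite -mkqE; split; first exact: conn_refl.
  by exists (fun=> 0), (fun=> 0); rewrite det_mx00 oner_neq0.
have Pub m : P m -> (m <= k)%N.
  by move=> /asboolP [A [B [i1 [i2 [j1 [j2 [_ /hankel_ge_le]]]]]]].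
have [m /asboolP [A [B [i1 [i2 [j1 [j2 [q0q nd]]]]]]] mmax] := ex_maxnP P0 Pub.
have max A' B' i1' i2' j1' j2' : conn q0 (mkq A' B' i1' i2' j1' j2') ->
    ~ hankel_ge (m + 1) (markov j2' A' i1').
  move=> c nd'; have /mmax : P (m + 1)%N by apply/asboolP; exists A', B', i1', i2', j1', j2'.
  by rewrite addn1 ltnn.
exists A, B, i1, i2, j1, j2; split=> // phi0 hphi0; apply/eqP; apply: contraT => nphi0.
have [Q [lam [phin0 ephi]]] := eigen_in A nphi0.
set phi := phi0 *m horner_mx A Q in phin0 ephi.
have phii : phi *m i1 = 0.
  apply/matrixP => a b; rewrite !ord1 -[LHS]/(matel _ _ _) -mom_horner mxE.
  by apply: big1 => d _; rewrite /markov /matel hphi0 mxE mulr0.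
pose A1 := A + 1 *: (i1 *m j2).
have ephi1 : phi *m A1 = lam *: phi.
  by rewrite mulmxDr scale1r mulmxA phii mul0mx addr0.
have q0q1 := conn_trans q0q (conn_feedback 1 A B i1 i2 j1 j2); rewrite -/A1 in q0q1.
have nd1 : hankel_ge m (markov j2 A1 i1) by apply: hankel_ge_feedback.
have [C [C0 hC minC]] := min_ann A j2 i1.
have [C1 [C10 hC1 minC1]] := min_ann A1 j2 i1.
have rC : root C lam.
  apply: (root_of_trace_deriv phin0 ephi (e := 9)) => S.
  exact: (trace_deriv0 mom0 max q0q nd hC).
have rC1 : root C1 lam.
  apply: (root_of_trace_deriv phin0 ephi1 (e := 9)) => S.
  exact: (trace_deriv0 mom0 max q0q1 nd1 hC1).
have split_root D mu : root D lam -> D != 0 -> ann mu D ->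
    (forall R : {poly F}, R != 0 -> (size R < size D)%N -> ~ ann mu R) ->
    exists R, ann mu (R * ('X - lam%:P)) /\ mom mu R != 0.
  move=> /factor_theorem [R ->] D0 hD minD; exists R; split=> //.
  have R0 : R != 0 by apply: contraNneq D0 => ->; rewrite mul0r.
  apply: (root_ann hD); apply: minD => //.
  by rewrite size_Mmonic ?monicXsubC // size_XsubC addn2.
have [R [hR R0]] := split_root _ _ rC C0 hC minC.
have [R1 [hR1 R10]] := split_root _ _ rC1 C10 hC1 minC1.
have [S eS] := feedback_right 1 A i1 j2 R1; rewrite -/A1 in eS.
have [S1 eS1] : exists S1, j2 *m horner_mx A R = j2 *m horner_mx A1 S1.
  have -> : A = A1 + (- 1) *: (i1 *m j2) by rewrite /A1 scaleNr addrK.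
  exact: feedback_left.
pose x := horner_mx A1 ('X - lam%:P).
have z1 : matel j2 (horner_mx A R *m x *m horner_mx A S) i1 = 0.
  have := ann_mom S1 hR1; rewrite mom_horner => <-.
  have -> : R1 * ('X - lam%:P) * S1 = S1 * ('X - lam%:P) * R1 by ring.
  rewrite !rmorphM /= -!mulmxE -/x /matel.
  by rewrite !mulmxA eS1 -!mulmxA eS.
have ex : x = horner_mx A ('X - lam%:P) + i1 *m j2.
  by rewrite /x !rmorphB /= !horner_mx_X !horner_mx_C /A1 scale1r addrAC.
have z2 : matel j2 (horner_mx A R *m x *m horner_mx A S) i1 = mom (markov j2 A i1) R * mom (markov j2 A1 i1) R1.
  rewrite ex mulmxDr mulmxDl matel_addm matel_rank1 !mom_horner.
  have := ann_mom S hR; rewrite mom_horner !rmorphM /= -!mulmxE => ->.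
  by rewrite add0r; congr (_ * _); rewrite /matel -!mulmxA eS.
by move: (mulf_neq0 R0 R10); rewrite -z2 z1 eqxx.
Qed.

End Cyclic.

(** * Setting the second row *)

Section Subspace.
Variables (F : fieldType) (k : nat) (U : 'rV[F]_k -> Prop).
Hypothesis U0 : U 0.
Hypothesis U_lin : forall a u v, U u -> U v -> U (a *: u + v).

Lemma subspace_mx : exists M : 'M[F]_k, forall u, U u <-> (u <= M)%MS.
Proof.
pose P r := `[< exists M : 'M[F]_k, (forall u, (u <= M)%MS -> U u) /\ \rank M = r >].
have exP : exists r, P r.
  exists 0%N; apply/asboolP; exists 0; rewrite mxrank0; split=> // u.
  by rewrite submx0 => /eqP ->.
have ub r : P r -> (r <= k)%N by move=> /asboolP [M [_ <-]]; apply: rank_leq_col.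
have [r /asboolP [M [hM rM]] rmax] := ex_maxnP exP ub.
exists M => u; split=> [Uu|]; last exact: hM.
have hMu w : (w <= M + u)%MS -> U w.
  move=> /sub_addsmxP [[x y] /= ->].
  rewrite addrC [y]mx11_scalar mul_scalar_mx; apply: U_lin => //.
  by apply: hM; apply: submxMl.
have /rmax : P (\rank (M + u)%MS) by apply/asboolP; exists (M + u)%MS.
rewrite -rM => le; have [_] := mxrank_leqif_sup (addsmxSl M u).
rewrite eqn_leq le mxrankS ?addsmxSl // => /esym sub.
exact: submx_trans (addsmxSr M u) sub.
Qed.

Lemma subspace_full :
  (forall psi : 'cV[F]_k, (forall u, U u -> u *m psi = 0) -> psi = 0) -> forall v, U v.
Proof.
move=> h v; have [M hM] := subspace_mx; apply/hM; rewrite submxE.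
suff -> : cokermx M = 0 by rewrite mulmx0.
apply/matrixP => a b; have /(congr1 (fun c : 'cV_k => c a 0)) : col b (cokermx M) = 0.
  apply: h => u /hM; rewrite submxE colE mulmxA => /eqP ->.
  by rewrite mul0mx.
by rewrite !mxE.
Qed.
End Subspace.

Lemma unitmx_ker (F : fieldType) k (E : 'M[F]_k) :
  (forall phi : 'rV[F]_k, phi *m E = 0 -> phi = 0) -> E \in unitmx.
Proof.
move=> h; rewrite -row_free_unit -kermx_eq0; apply/eqP/row_matrixP => a.
by rewrite row0; apply: h; rewrite -row_mul mulmx_ker row0.
Qed.

Section RowGeneration.
Variables (F : numFieldType) (k : nat) (tau : F).
Variables (A B : 'M[F]_k) (i : 'cV[F]_k) (j : 'rV[F]_k).
Hypothesis tau0 : tau != 0.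
Hypothesis AB : A *m B - B *m A = tau%:M + i *m j.

Definition killed (psi : 'cV[F]_k) := forall s d, matel j ((A + s *: B) ^+ d) psi = 0.

(** Differentiating [j (A + s B)^(d+1) psi = 0] in [s] gives a sum of
    [d + 1] terms, which are equal since moving [B] to the right only produces
    terms [tau j X^e psi] and [(j X^e i) (j X^f psi)], where [X = A + s B]. *)
Lemma killedB psi : killed psi -> killed (B *m psi).
Proof.
move=> hpsi s d; set X := A + s *: B.
have XB : X * B - B * X = tau%:M + i *m j.
  by rewrite /X -!mulmxE mulmxDl mulmxDr -AB -scalemxAl -scalemxAr opprD addrACA subrr addr0.
pose Y h := \sum_(l < d.+1) (X + h *: B) ^+ l *m B *m X ^+ (d.+1 - l.+1).
have Y0 : forall h, matel j (Y h) psi = 0.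
  apply: polyfun_extend0.
    apply: polyfun_matel; [exact: polymx_cst| |exact: polymx_cst].
    apply: polymx_sum => l; apply: polymxM; last exact: polymx_cst.
    by apply: polymxM; [apply/polymxX/polymx_affine | apply: polymx_cst].
  move=> h h0.
  have eY : (X + h *: B) ^+ d.+1 = X ^+ d.+1 + h *: Y h.
    have := telescope_comm (X + h *: B) 1 X d.+1; rewrite !mulr1 !mul1r => /eqP.
    rewrite eq_sym subr_eq => /eqP ->; rewrite addrC; congr (_ + _).
    rewrite scaler_sumr; apply: eq_bigr => l _.
    have -> : X + h *: B - X = h *: B by rewrite addrC addKr.
    by rewrite -!mulmxE -scalemxAr -scalemxAl.
  have := hpsi (s + h) d.+1.
  have -> : A + (s + h) *: B = X + h *: B by rewrite scalerDl addrA.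
  rewrite eY matelDm hpsi add0r => /eqP; rewrite mulf_eq0 (negbTE h0) => /eqP //.
have term (l : 'I_d.+1) : matel j (X ^+ l *m B *m X ^+ (d.+1 - l.+1)) psi = matel j (X ^+ d *m B) psi.
  have ed : (l + (d.+1 - l.+1))%N = d by rewrite subSS subnKC // -ltnS.
  apply/eqP; rewrite eq_sym -subr_eq0 -matel_subm -{1}ed exprD -!mulmxE -!mulmxA -mulmxBr !mulmxE.
  rewrite -telescope_comm mulr_sumr matel_sum big1 // => p _.
  set q := (_ - p.+1)%N.
  have -> : X ^+ l * (X ^+ p * (X * B - B * X) * X ^+ q) =
      X ^+ (l + p) *m (i *m j) *m X ^+ q + tau *: X ^+ (l + p + q).
    rewrite XB mulrDr mulrDl mulrDr addrC; congr (_ + _).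
      by rewrite -!mulmxE !mulmxA mulmxE -exprD.
    by rewrite -!mulmxE mul_mx_scalar -scalemxAl -scalemxAr !mulmxE mulrA -!exprD.
  by apply: (etrans (matelDm _ _ _ _ _)); rewrite matel_rank1 !hpsi !mulr0 addr0.
have := Y0 0; rewrite /Y scale0r addr0 matel_sum (eq_bigr _ (fun l _ => term l)).
rewrite sumr_const card_ord => /eqP; rewrite mulrn_eq0 /= => /eqP.
by rewrite matel_mulr.
Qed.

Lemma killedA psi : killed psi -> killed (A *m psi).
Proof.
move=> hpsi s d; have := killedB hpsi s d; rewrite !matel_mulr => hB.
have := hpsi s d.+1; rewrite exprSr -mulmxE mulmxDr -scalemxAr.
by move=> /(etrans (esym (matelDm _ _ _ _ _))); rewrite hB mulr0 addr0.
Qed.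

(** The vectors [killed] form a subspace stable under [A] and [B] on which
    [[A, B] = tau], because it lies in the kernel of [j].  Taking traces shows
    that it is zero. *)
Lemma killed_eq0 psi : killed psi -> psi = 0.
Proof.
pose U (u : 'rV[F]_k) := killed u^T.
have [r [R [fR hR]]] : exists r (R : 'M[F]_(r, k)),
    row_free R /\ forall u, U u <-> (u <= R)%MS.
  have [|a u v hu hv s d|N hN] := @subspace_mx F k U.
  - by move=> s d; rewrite /matel trmx0 mulmx0 mxE.
  - by rewrite linearP /= [a *: _ + _]addrC matelDr hu hv mulr0 addr0.
  by exists _, (row_base N); split=> [|u]; rewrite ?row_base_free // eq_row_base.
have memR a : U (row a R) by apply/hR; apply: row_sub.
have stab (C : 'M[F]_k) : (forall psi, killed psi -> killed (C *m psi)) ->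
    exists C', R *m C^T = C' *m R.
  move=> hC; apply/submxP; apply/row_subP => a; rewrite row_mul; apply/hR.
  by rewrite /U trmx_mul trmxK; apply: hC; apply: memR.
have [A' hA] := stab A killedA; have [B' hB] := stab B killedB.
have Rj : R *m j^T = 0.
  apply/matrixP => a c; rewrite ord1 [RHS]mxE.
  have := memR a 0 0%N; rewrite /matel expr0 mulmx1 => <-.
  by rewrite -[R *m _]trmxK trmx_mul trmxK mxE [in LHS]mxE [in RHS]mxE; apply: eq_bigr => l _; rewrite !mxE.
have e : (A' *m B' - B' *m A') *m R = (- tau)%:M *m R.
  rewrite mulmxBl -!mulmxA -hA -hB !mulmxA -hA -hB -!mulmxA -mulmxBr.
  have -> : A^T *m B^T - B^T *m A^T = - (A *m B - B *m A)^T.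
    by rewrite linearB /= !trmx_mul opprB.
  rewrite AB linearD /= tr_scalar_mx trmx_mul mulmxN mulmxDr mulmxA Rj mul0mx addr0.
  by rewrite mul_mx_scalar mul_scalar_mx scaleNr.
have /(congr1 mxtrace) := row_free_inj fR e.
rewrite linearB /= mxtrace_mulC subrr mxtrace_scalar => /esym/eqP.
rewrite mulrn_eq0 oppr_eq0 (negbTE tau0) orbF => /eqP r0 hpsi.
have /hR : U psi^T by rewrite /U trmxK.
have -> : R = 0 by apply/eqP; rewrite -mxrank_eq0 -leqn0 -r0 rank_leq_row.
by move=> /submxP [D]; rewrite mulmx0 => /(congr1 trmx); rewrite trmxK trmx0.
Qed.
End RowGeneration.

(** * Normal form and transitivity *)

Section NormalForm.
Variables (F : numClosedFieldType) (n : nat) (tau : F).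
Hypothesis tau0 : tau != 0.
Local Notation k := n.+1.
Implicit Types (A B : 'M[F]_k) (phi j : 'rV[F]_k) (i : 'cV[F]_k).

Lemma cyclic_gen A i v : cyclic A i -> exists P, v = horner_mx A P *m i.
Proof.
move=> cyc; suff [P e] : exists P, v^T = (horner_mx A P *m i)^T.
  by exists P; apply: trmx_inj.
apply: (@subspace_full F k (fun u => exists P, u = (horner_mx A P *m i)^T)) => [|a x y|psi h].
- by exists 0; rewrite rmorph0 mul0mx trmx0.
- move=> [P ->] [Q ->]; exists (a *: P + Q).
  by rewrite linearP /= mulmxDl -scalemxAl linearP.
apply: trmx_inj; rewrite trmx0; apply: cyc => d.
apply: trmx_inj; rewrite trmx0 -mulmxA trmx_mul trmxK; apply: h.
by exists 'X^d; rewrite rmorphXn /= horner_mx_X.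
Qed.

Lemma horner_mx_sum A (P : {poly F}) : horner_mx A P = \sum_(d < size P) P`_d *: A ^+ d.
Proof.
rewrite -{1}[P]coefK poly_def linear_sum; apply: eq_bigr => d _.
by rewrite linearZ /= rmorphXn /= horner_mx_X.
Qed.

Lemma conn_kill P A B i1 i2 j1 j2 : exists B' j1',
  conn (mkq A B i1 i2 j1 j2) (mkq A B' i1 (i2 - horner_mx A P *m i1) j1' j2).
Proof.
rewrite horner_mx_sum; elim: (size P) => [|N [B' [j1' IH]]].
  exists B, j1; rewrite big_ord0 mul0mx subr0; exact: conn_refl.
have := conn_trans IH (conn_cycle P`_N N _ _ _ _ _ _).
rewrite big_ord_recr /= mulmxDl opprD addrA -scalemxAl => c.
by eexists; eexists; exact: c.
Qed.

Lemma conn_B P A B i1 i2 j1 j2 :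
  conn (mkq A B i1 i2 j1 j2) (mkq A (B + horner_mx A P) i1 i2 j1 j2).
Proof.
rewrite horner_mx_sum; elim: (size P) => [|N IH].
  rewrite big_ord0 addr0; exact: conn_refl.
rewrite big_ord_recr /= addrA; exact: conn_trans IH (conn_addpow _ _ _ _ _ _ _ _).
Qed.

(** By [conn_row] the row [j2] can be translated by the rows
    [j1 (A + s B)^n], which span all rows by [killed_eq0]. *)
Lemma conn_set_row A B i1 j1 j2 j2' : A *m B - B *m A = tau%:M + i1 *m j1 ->
  conn (mkq A B i1 0 j1 j2) (mkq A B i1 0 j1 j2').
Proof.
move=> AB.
pose U v := forall c j, conn (mkq A B i1 0 j1 j) (mkq A B i1 0 j1 (j + c *: v)).
have : U (j2' - j2).
  apply: subspace_full => [c j|a u v hu hv c j|psi h].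
  - by rewrite scaler0 addr0; apply: conn_refl.
  - by rewrite scalerDr scalerA addrA; apply: conn_trans (hu _ _) (hv _ _).
  apply: (killed_eq0 tau0 AB) => s d; rewrite /matel h ?mxE // => c j.
  exact: conn_row.
by move=> /(_ 1 j2); rewrite scale1r addrC subrK.
Qed.

Lemma moment_AB A B i1 j1 j2 : moment (mkq A B i1 0 j1 j2) = tau%:M ->
  A *m B - B *m A = tau%:M + i1 *m j1.
Proof. by rewrite moment_mkq mul0mx addr0 => /eqP; rewrite subr_eq => /eqP. Qed.

Definition shift_mx : 'M[F]_k := \matrix_(a, b) (a == b.+1 :> nat)%:R.
Definition ecol0 : 'cV[F]_k := delta_mx 0 0.

Lemma shift_e0 d (a : 'I_k) : (shift_mx ^+ d *m ecol0) a 0 = (a == d :> nat)%:R.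
Proof.
elim: d a => [|d IH] a; first by rewrite expr0 mul1mx mxE eqxx andbT.
rewrite exprS -mulmxE -mulmxA mxE.
have [dk|kd] := ltnP d k.
  rewrite (bigD1 (Ordinal dk)) //= IH eqxx mulr1 mxE big1 ?addr0 // => b nb.
  by rewrite IH [b == d :> nat](negbTE nb) mulr0.
rewrite big1 => [|b _]; last by rewrite IH ltn_eqF ?mulr0 // (leq_trans (ltn_ord b)).
by rewrite ltn_eqF // (leq_trans (ltn_ord a)) // ltnW.
Qed.

Lemma shift_e0E (d : 'I_k) : shift_mx ^+ d *m ecol0 = delta_mx d 0.
Proof. by apply/matrixP => a b; rewrite !ord1 shift_e0 mxE eqxx andbT. Qed.

Lemma mx_ext_shift m (M N : 'M[F]_(m, k)) :
  (forall d : 'I_k, M *m (shift_mx ^+ d *m ecol0) = N *m (shift_mx ^+ d *m ecol0)) -> M = N.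
Proof.
move=> h; apply/matrixP => a b; have := h b; rewrite shift_e0E -!colE.
by move=> /(congr1 (fun c : 'cV_m => c a 0)); rewrite !mxE.
Qed.

Lemma cyclic_shift : cyclic shift_mx ecol0.
Proof. by move=> phi h; apply: mx_ext_shift => d; rewrite mul0mx mulmxA. Qed.

Lemma drop_poly_step (p : {poly F}) d : drop_poly d p = 'X * drop_poly d.+1 p + (p`_d)%:P.
Proof.
apply/polyP => a; rewrite coefD coefXM coefC !coef_drop_poly.
by case: a => [|a] /=; rewrite ?add0r ?addr0 // addSnnS.
Qed.

(** In the basis of the Horner polynomials of the characteristic polynomial,
    evaluated at [A] and applied to [i], a cyclic pair is the nilpotent shift up
    to a feedback term [i delta]. *)
Lemma horner_basis A i : cyclic A i -> exists (E : 'M[F]_k) (delta : 'rV[F]_k),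
  [/\ E \in unitmx, E *m ecol0 = i & A *m E = E *m (shift_mx - ecol0 *m delta)].
Proof.
move=> cyc; pose D := char_poly A.
have szD : size D = k.+1 by rewrite size_char_poly.
pose h d := horner_mx A (drop_poly (k - d) D) *m i.
pose E := \matrix_(a < k, b < k) h b a 0; pose delta := \row_(b < k) D`_(k - b.+1).
have h0 : h 0%N = i.
  rewrite /h subn0; have -> : drop_poly k D = 1.
    apply/polyP => a; rewrite coef_drop_poly coef1; case: a => [|a].
      by have := char_poly_monic A; rewrite -/D qualifE /= lead_coefE szD => /eqP.
    by rewrite nth_default // szD addSn ltnS leq_addl.
  by rewrite rmorph1 mul1mx.
have hk : h k = 0.
  by rewrite /h subnn drop_poly0l Cayley_Hamilton mul0mx.
have hS d : (d < k)%N -> A *m h d = h d.+1 - D`_(k - d.+1) *: i.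
  move=> dk; rewrite /h (drop_poly_step _ (k - d.+1)) subnSK // rmorphD rmorphM /=.
  by rewrite horner_mx_X horner_mx_C mulmxDl mul_scalar_mx addrK -mulmxE mulmxA.
have Ee0 : E *m ecol0 = i.
  by rewrite -colE; apply/matrixP => a b; rewrite ord1 [LHS]mxE [LHS]mxE h0.
have AE : A *m E = E *m (shift_mx - ecol0 *m delta).
  rewrite mulmxBr mulmxA Ee0; apply/matrixP => a b.
  have -> : (A *m E) a b = (A *m h b) a 0.
    by rewrite !mxE; apply: eq_bigr => c _; rewrite !mxE.
  rewrite hS // [LHS]mxE [RHS]mxE; congr (_ + _); last first.
    by rewrite !mxE big_ord1 !mxE mulrC.
  rewrite [RHS]mxE; have [bk|kb] := ltnP b.+1 k.
    rewrite (bigD1 (Ordinal bk)) //= [shift_mx _ _]mxE eqxx mulr1 [E _ _]mxE.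
    rewrite big1 ?addr0 // => c nc.
    by rewrite [shift_mx _ _]mxE [c == b.+1 :> nat](negbTE nc) mulr0.
  have -> : b.+1 = k by apply/eqP; rewrite eqn_leq kb ltn_ord.
  rewrite hk mxE big1 // => c _; rewrite [shift_mx _ _]mxE ltn_eqF ?mulr0 //.
  exact: leq_trans (ltn_ord c) kb.
exists E, delta; split=> //.
have AdE d : A ^+ d *m E = E *m (shift_mx - ecol0 *m delta) ^+ d.
  elim: d => [|d IH]; first by rewrite !expr0 mul1mx mulmx1.
  by rewrite exprSr exprS -!mulmxE -mulmxA AE mulmxA IH -mulmxA mulmxE -exprSr exprS.
apply: unitmx_ker => phi hphi; apply: cyc => d.
by rewrite -Ee0 -!mulmxA [A ^+ d *m _]mulmxA AdE !mulmxA hphi !mul0mx.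
Qed.

Lemma gl_act_mkq g A B i1 i2 j1 j2 : gl_act g (mkq A B i1 i2 j1 j2) =
  mkq (g *m A *m invmx g) (g *m B *m invmx g) (g *m i1) (g *m i2) (j1 *m invmx g) (j2 *m invmx g).
Proof. by rewrite /gl_act /mkq /qA /qB /qi /qj /= mul_mx_row mul_col_mx. Qed.

Lemma conn_kill_all q A B i1 i2 j1 j2 : conn q (mkq A B i1 i2 j1 j2) -> cyclic A i1 ->
  exists B' j1', conn q (mkq A B' i1 0 j1' j2).
Proof.
move=> c /cyclic_gen - /(_ i2) [P eP].
have [B' [j1']] := conn_kill P A B i1 i2 j1 j2; rewrite -eP subrr => c'.
by exists B', j1'; apply: conn_trans c c'.
Qed.

(** Once [i1] is cyclic, [i2] can be removed and [j2] is free; choosing for it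
    the feedback that turns [A] into a nilpotent shift gives the normal form. *)
Lemma reach_normal (q : quad F k) : moment q = tau%:M ->
  exists B j1, conn q (mkq shift_mx B ecol0 0 j1 0).
Proof.
move=> mq.
have [A [B [i1 [i2 [j1 [j2 [c cyc]]]]]]] := reach_cyclic tau0 mq.
have {c} [B1 [j11 c]] := conn_kill_all c cyc.
have [E [delta [uE Ee0 AE]]] := horner_basis cyc.
have AB := moment_AB (conn_moment c mq).
have {}c := conn_trans c (conn_set_row j2 (delta *m invmx E) AB).
have {}c := conn_trans c (conn_feedback 1 _ _ _ _ _ _).
have uE' : invmx E \in unitmx by rewrite unitmx_inv.
have {}c := conn_trans c (conn_gl _ uE').
have ei : invmx E *m i1 = ecol0 by rewrite -Ee0 mulKmx.
rewrite gl_act_mkq invmxK ei in c.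
have eA : invmx E *m (A + 1 *: (i1 *m (delta *m invmx E))) *m E = shift_mx.
  rewrite scale1r -mulmxA mulmxDl AE -[i1 *m _ *m E]mulmxA mulmxKV //.
  by rewrite -Ee0 -mulmxA -mulmxDr subrK mulKmx.
rewrite eA in c.
have {c} [B2 [j12 c]] := conn_kill_all c cyclic_shift.
have AB2 := moment_AB (conn_moment c mq).
by exists B2, j12; exact: (conn_trans c (conn_set_row _ 0 AB2)).
Qed.

(** The moment equation determines the row: the difference [j' - j] times
    [S^d e_0] is the trace of [S^d [S, B' - B]], that is zero.  So [B' - B]
    commutes with the shift, hence is a polynomial in it. *)
Lemma conn_normal B B' j j' : moment (mkq shift_mx B ecol0 0 j 0) = tau%:M ->
  moment (mkq shift_mx B' ecol0 0 j' 0) = tau%:M ->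
  conn (mkq shift_mx B ecol0 0 j 0) (mkq shift_mx B' ecol0 0 j' 0).
Proof.
move=> /moment_AB m1 /moment_AB m2.
pose X := B' - B.
have eX : shift_mx *m X - X *m shift_mx = ecol0 *m (j' - j).
  have <- : shift_mx *m B' - B' *m shift_mx - (shift_mx *m B - B *m shift_mx) = ecol0 *m (j' - j).
    by rewrite m1 m2 opprD addrACA subrr add0r mulmxBr.
  rewrite /X mulmxBr mulmxBl !opprB [LHS]addrACA [RHS]addrACA; congr (_ + _).
  exact: addrC.
have ej : j' - j = 0.
  apply: cyclic_shift => d; apply/matrixP => a b; rewrite !ord1 [RHS]mxE -[LHS]/(matel _ _ _).
  rewrite matel_tr -eX mulmxBr linearB /= (mulmxA _ X) (mxtrace_mulC (_ *m X)) !mulmxA.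
  by rewrite !mulmxE -exprSr -exprS subrr.
have [P eP] := cyclic_gen (X *m ecol0) cyclic_shift.
have -> : B' = B + horner_mx shift_mx P.
  apply/eqP; rewrite addrC -subr_eq; apply/eqP/mx_ext_shift => d.
  have comm : X *m shift_mx ^+ d = shift_mx ^+ d *m X.
    apply: commrX; apply/esym/eqP; rewrite -subr_eq0 -!mulmxE.
    by rewrite eX ej mulmx0.
  rewrite -/X mulmxA comm -mulmxA eP !mulmxA; congr (_ *m _).
  have -> : shift_mx ^+ d = horner_mx shift_mx 'X^d by rewrite rmorphXn /= horner_mx_X.
  by rewrite !mulmxE -!rmorphM mulrC.
rewrite (_ : j' = j); last by apply/eqP; rewrite -subr_eq0 ej.
exact: conn_B.
Qed.

Lemma conn_level (q q' : quad F k) : moment q = tau%:M -> moment q' = tau%:M -> conn q q'.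
Proof.
move=> mq mq'; have [B [j c]] := reach_normal mq; have [B' [j' c']] := reach_normal mq'.
have cn := conn_normal (conn_moment c mq) (conn_moment c' mq').
exact: conn_trans c (conn_trans cn (conn_sym c')).
Qed.

Lemma transitive_N : acts_transitively (symp_aut_action k tau).
Proof.
move=> t u; have [f [g [Pf ug e]]] := conn_level (eqP (valP (ofN t))) (eqP (valP (ofN u))).
exists (exist _ f (introT (asboolP _) Pf) : symp_aut F).
rewrite -[RHS]ofNK -[LHS]/(act_N _ _) -[t]ofNK act_N_toN.
by apply/toN_eq/asboolP; exists g => //=; rewrite ofNK.
Qed.

End NormalForm.

Local Open Scope complex_scope.

Theorem theorem2 (R : realType) (k : nat) (tau : R[i])
    (hk : (1 <= k)%N) (htau : tau != 0) :
  acts_transitively (symp_aut_action k tau).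
Proof.
case: k hk => [//|k _]; exact: (@transitive_N (R[i] : numClosedFieldType) k tau htau).
Qed.
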